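(* Let $(P,\mu^P),(Q,\mu^Q)\in\mathfrak{M}_n$ be weighted point clouds. The following statements hold for the robust sliced-Wasserstein distance $\mathrm{RSWD}(\cdot,\cdot)$. 1. If $(P',\mu^{P'})\in\mathfrak{M}_n$ and $(P,\mu^P)\sim(P',\mu^{P'})$, then $\mathrm{RSWD}\big((P,\mu^P),(Q,\mu^Q)\big)=\mathrm{RSWD}\big((P',\mu^{P'}),(Q,\mu^{Q})\big)$. 2. $\mathrm{RSWD}\big((P,\mu^P),(Q,\mu^Q)\big)\ge0$, and $\mathrm{RSWD}\big((P,\mu^P),(Q,\mu^Q)\big)=0$ if and only if $(P,\mu^P)\sim(Q,\mu^Q)$. 3. $\mathrm{RSWD}\big((P,\mu^P),(Q,\mu^Q)\big)=\mathrm{RSWD}\big((Q,\mu^Q),(P,\mu^P)\big)$. 4. For any $(S,\mu^S)\in\mathfrak{M}_n$, $\mathrm{RSWD}\big((P,\mu^P),(Q,\mu^Q)\big)\le\mathrm{RSWD}\big((P,\mu^P),(S,\mu^S)\big)+\mathrm{RSWD}\big((S,\mu^S),(Q,\mu^Q)\big)$. Therefore $\mathrm{RSWD}(\cdot,\cdot)$ defines a distance (metric) on the quotient space $\mathfrak{M}_n/\sim$.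
   Context: Points of $\mathbb{R}^n$ are row vectors, $O(n)=\{R\in\mathbb{R}^{n\times n}: RR^T=I_n\}$, and $S^{n-1}$ is the unit sphere in $\mathbb{R}^n$ (of row vectors $\theta$) with its standard surface measure $\mathrm{d}\theta$ (counting measure on $\{\pm1\}$ if $n=1$). The space of weighted point clouds is $$\mathfrak{M}_n=\bigcup_{\ell=1}^{\infty}\Big\{(P,\mu)=\{(p_i,\mu_i)\in\mathbb{R}^n\times\mathbb{R}_+\}_{i=1}^{\ell}\ :\ \sum_{i=1}^{\ell}\mu_i=1,\ p_i\ne p_j\text{ if }i\ne j\Big\},$$ where $\mathbb{R}_+$ denotes the strictly positive reals. The equivalence relation $(P,\mu^P)\sim(Q,\mu^Q)$ means: the two clouds have the same number of points $\ell_P=\ell_Q$, and there exist $R\in O(n)$ and a permutation $\pi$ of $\{1,\dots,\ell_P\}$ such that $p_iR=q_{\pi(i)}$ and $\mu^P_i=\mu^Q_{\pi(i)}$ for all $i$. For $\theta\in S^{n-1}$ and $R\in O(n)$, let $\mu^P_{\theta,R}=\sum_i\mu^P_i\delta_{p_iR\theta^T}$ and $\mu^Q_\theta=\sum_j\mu^Q_j\delta_{q_j\theta^T}$ be the probability measures on $\mathbb{R}$ induced by the projections $p_i\mapsto p_iR\theta^T$ and $q_j\mapsto q_j\theta^T$. A transport plan in $\mathrm{ADM}(\mu^P_{\theta,R},\mu^Q_\theta)$ is a coupling of these two measures, represented by a nonnegative matrix $\sigma\in\mathbb{R}^{\ell_P\times\ell_Q}$ with $\sum_j\sigma_{ij}=\mu^P_i$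 and $\sum_i\sigma_{ij}=\mu^Q_j$ (if several points project to the same real number, different matrices may represent the same coupling, which does not affect the cost). The robust sliced-Wasserstein distance $\mathrm{RSWD}\ge0$ is defined by $$\mathrm{RSWD}\big((P,\mu^P),(Q,\mu^Q)\big)^2=\min_{R\in O(n)}\int_{S^{n-1}}\ \min_{\sigma\in\mathrm{ADM}(\mu^P_{\theta,R},\mu^Q_\theta)}\ \sum_{i,j}\sigma_{ij}\,|p_iR\theta^T-q_j\theta^T|^2\ \mathrm{d}\theta .$$ *)

(* Defs.v *)
From HB Require Import structures.
From mathcomp Require Import all_boot all_order all_algebra all_fingroup.
From mathcomp Require Import generic_quotient.
From mathcomp Require Import all_classical all_reals all_analysis.
From mathcomp Require Import measurable_realfun.

Set Implicit Arguments.
Unset Strict Implicit.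
Unset Printing Implicit Defensive.

Import Order.TTheory GRing.Theory Num.Theory.
Import numFieldNormedType.Exports.

Local Open Scope classical_set_scope.
Local Open Scope ring_scope.
Local Open Scope quotient_scope.

(* Row vectors carry the product sigma-algebra of the Borel sets of R, as
   [n.-tuple] does in the library; it is the Borel sigma-algebra of R^n. *)
Section measurable_rV.
Context {R : realType} {n : nat}.

Let coors : 'I_n -> 'rV[R]_n -> R := fun i v => v ord0 i.

Let rV_set0 : g_sigma_preimage coors set0.
Proof. exact: sigma_algebra0. Qed.

Let rV_setC A : g_sigma_preimage coors A -> g_sigma_preimage coors (~` A).
Proof. exact: sigma_algebraC. Qed.

Let rV_bigcup (F : _^nat) : (forall i, g_sigma_preimage coors (F i)) ->
  g_sigma_preimage coors (\bigcup_i (F i)).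
Proof. exact: sigma_algebra_bigcup. Qed.

HB.instance Definition _ := @isMeasurable.Build
  (measure_tuple_display default_measure_display)
  'rV[R]_n (g_sigma_preimage coors) rV_set0 rV_setC rV_bigcup.

End measurable_rV.

Lemma measurable_coord (R : realType) (n : nat) (i : 'I_n) :
  measurable_fun [set: 'rV[R]_n] (fun v : 'rV[R]_n => v ord0 i).
Proof.
move=> _ Y mY; rewrite setTI; apply: sub_sigma_algebra => /=.
rewrite -bigcup_seq/=; exists i => /=; first by rewrite mem_index_enum.
by exists Y => //; rewrite setTI.
Qed.

Lemma measurable_fun_coordP d (T : measurableType d) (R : realType) (n : nat)
    (f : T -> 'rV[R]_n) :
  measurable_fun [set: T] f <->
  forall i, measurable_fun [set: T] (fun x => f x ord0 i).
Proof.
split=> [mf i|mf].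
  exact: (measurableT_comp (measurable_coord i) mf).
move=> _ A mA; rewrite setTI; move: A mA.
apply: smallest_sub.
  split => [|B mB|F mF].
  - by rewrite preimage_set0; exact: measurable0.
  - by rewrite setTD preimage_setC; exact: measurableC.
  - by rewrite preimage_bigcup; apply: bigcup_measurable => k _; exact: mF.
rewrite -bigcup_seq; apply: bigcup_sub => i _ A [B mB <-].
by rewrite setTI; have := mf i measurableT B mB; rewrite setTI.
Qed.

(* Prepending a coordinate; ['rV_(1 + n)] and ['rV_n.+1] are convertible. *)
Section lebesgue_cons.
Context {R : realType} {n : nat}.

Definition rV_cons (p : measurableTypeR R * 'rV[R]_n) : 'rV[R]_n.+1 :=
  (row_mx (p.1 : R)%:M p.2 : 'rV[R]_(1 + n)).

Definition rV_uncons (v : 'rV[R]_n.+1) : measurableTypeR R * 'rV[R]_n :=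
  (v ord0 ord0, rsubmx (v : 'rV[R]_(1 + n))).

Lemma rV_cons_head (p : measurableTypeR R * 'rV[R]_n) (j : 'I_1) :
  rV_cons p ord0 (lshift n j) = p.1.
Proof. by rewrite [LHS]row_mxEl mxE (ord1 j) eqxx mulr1n. Qed.

Lemma rV_cons_tail (p : measurableTypeR R * 'rV[R]_n) (k : 'I_n) :
  rV_cons p ord0 (rshift 1 k) = p.2 ord0 k.
Proof. by rewrite [LHS]row_mxEr. Qed.

Lemma rV_consK : cancel rV_cons rV_uncons.
Proof.
move=> [x v]; congr pair.
  have -> : (ord0 : 'I_n.+1) = lshift n (ord0 : 'I_1) by exact/val_inj.
  exact: rV_cons_head.
by apply/rowP => k; rewrite mxE rV_cons_tail.
Qed.

Lemma measurable_rV_cons : measurable_fun setT rV_cons.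
Proof.
apply/measurable_fun_coordP => i.
case: (splitP (i : 'I_(1 + n))) => [j ij|k ik].
  have -> : i = lshift n j by exact/val_inj.
  rewrite (_ : (fun _ => _) = fst); first exact: measurable_fst.
  by apply/funext => p; rewrite rV_cons_head.
have -> : i = rshift 1 k by exact/val_inj.
rewrite (_ : (fun _ => _) = (fun v : 'rV[R]_n => v ord0 k) \o snd).
  exact: (measurableT_comp (measurable_coord k) measurable_snd).
by apply/funext => p; rewrite rV_cons_tail.
Qed.
#[local] Hint Resolve measurable_rV_cons : core.

Lemma measurable_rV_uncons : measurable_fun setT rV_uncons.
Proof.
apply/measurable_fun_pairP; split; first exact: measurable_coord.
apply/measurable_fun_coordP => i.
rewrite (_ : (fun _ => _) = (fun v : 'rV[R]_n.+1 => v ord0 (rshift 1 i))).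
  exact: measurable_coord.
by apply/funext => v; rewrite /= mxE.
Qed.

Variable mu : {sigma_finite_measure set 'rV[R]_n -> \bar R}.

Definition lebesgue_cons : set 'rV[R]_n.+1 -> \bar R :=
  pushforward (@lebesgue_measure R \x mu)%E rV_cons.

Let lebesgue_cons0 : lebesgue_cons set0 = 0%E.
Proof. exact: measure0. Qed.

Let lebesgue_cons_ge0 A : (0 <= lebesgue_cons A)%E.
Proof. exact: measure_ge0. Qed.

Let lebesgue_cons_sigma_additive : semi_sigma_additive lebesgue_cons.
Proof. exact: measure_semi_sigma_additive. Qed.

HB.instance Definition _ := isMeasure.Build _ _ _ lebesgue_cons
  lebesgue_cons0 lebesgue_cons_ge0 lebesgue_cons_sigma_additive.

Let lebesgue_cons_sigma_finite : sigma_finite setT lebesgue_cons.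
Proof.
have /sigma_finiteP[F [FT ndF Foo]] := sigma_finiteT (@lebesgue_measure R).
have /sigma_finiteP[G [GT ndG Goo]] := sigma_finiteT mu.
exists (fun k => rV_uncons @^-1` (F k `*` G k)).
  apply/seteqP; split => // v _.
  have : [set: measurableTypeR R] (rV_uncons v).1 by [].
  rewrite FT => -[k _ Fk].
  have : [set: 'rV[R]_n] (rV_uncons v).2 by [].
  rewrite GT => -[l _ Gl].
  exists (maxn k l) => //; split.
  - by move: Fk; exact/subsetPset/ndF/leq_maxl.
  - by move: Gl; exact/subsetPset/ndG/leq_maxr.
move=> k; have [mF Fk] := Foo k; have [mG Gk] := Goo k; split.
  rewrite -[X in measurable X]setTI.
  by apply: measurable_rV_uncons => //; exact: measurableX.
rewrite /lebesgue_cons /pushforward -comp_preimage.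
rewrite (_ : rV_uncons \o rV_cons = id) ?preimage_id.
  by rewrite product_measure1E// lte_mul_pinfty// ge0_fin_numE.
by apply/funext => p; exact: rV_consK.
Qed.

HB.instance Definition _ := @Measure_isSigmaFinite.Build _ _ _ lebesgue_cons
  lebesgue_cons_sigma_finite.

End lebesgue_cons.

(* Lebesgue measure on R^n, as the iterated product of [lebesgue_measure]. *)
Fixpoint lebesgue_rV (R : realType) (n : nat) :
    {sigma_finite_measure set 'rV[R]_n -> \bar R} :=
  match n with
  | 0 => dirac (0 : 'rV[R]_0)
  | n'.+1 => lebesgue_cons (lebesgue_rV R n')
  end.

Section sphere.
Context {R : realType} {n : nat}.

(* The norm provided by the library on ['rV_n] is the sup norm. *)
Definition edot (u v : 'rV[R]_n) : R := (u *m v^T) ord0 ord0.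

Definition enorm (v : 'rV[R]_n) : R := Num.sqrt (edot v v).

Definition sphere : set 'rV[R]_n := [set v | enorm v = 1].

Definition punctured_ball : set 'rV[R]_n := [set v | 0 < enorm v <= 1].

Definition normalize (v : 'rV[R]_n) : 'rV[R]_n := (enorm v)^-1 *: v.

Lemma measurable_enorm : measurable_fun setT enorm.
Proof.
have mdot : measurable_fun setT (fun v : 'rV[R]_n => edot v v).
  rewrite (_ : (fun _ => _) = (fun v : 'rV[R]_n =>
    \sum_(i < n) v ord0 i * v ord0 i)); last first.
    apply/funext => v; rewrite /edot mxE.
    by apply: eq_bigr => i _; rewrite mxE.
  apply: measurable_sum => i.
  by apply: measurable_funM; exact: measurable_coord.
apply: measurableT_comp mdot.
by apply: continuous_measurable_fun; exact: sqrt_continuous.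
Qed.

Lemma measurable_punctured_ball : measurable punctured_ball.
Proof.
rewrite (_ : punctured_ball = setT `&` enorm @^-1` `]0, 1]%classic).
  by apply: measurable_enorm => //; exact: measurable_itv.
by rewrite setTI; apply/seteqP; split => v; rewrite /punctured_ball /= in_itv.
Qed.

Lemma measurable_normalize : measurable_fun setT normalize.
Proof.
apply/measurable_fun_coordP => i.
rewrite (_ : (fun _ => _) =
  (fun v : 'rV[R]_n => enorm v `^ (-1) * v ord0 i)); last first.
  by apply/funext => v; rewrite mxE powR_inv1// sqrtr_ge0.
apply: measurable_funM; last exact: measurable_coord.
exact: (measurableT_comp (measurable_powR (-1)) measurable_enorm).
Qed.
#[local] Hint Resolve measurable_normalize : core.

(* The cone formula for the surface measure of the sphere: a Borel subset A of
   S^(n-1) has measure n * Leb {v | 0 < |v| <= 1, v / |v| \in A}. For n = 1 it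
   is the counting measure on {1, -1}. *)
Definition surface_measure : set 'rV[R]_n -> \bar R :=
  pushforward
    (mscale (n%:R%:nng : {nonneg R})
      (mrestr (lebesgue_rV R n) measurable_punctured_ball))
    normalize.

Let surface_measure0 : surface_measure set0 = 0%E.
Proof. exact: measure0. Qed.

Let surface_measure_ge0 A : (0 <= surface_measure A)%E.
Proof. exact: measure_ge0. Qed.

Let surface_measure_sigma_additive : semi_sigma_additive surface_measure.
Proof. exact: measure_semi_sigma_additive. Qed.

HB.instance Definition _ := isMeasure.Build _ _ _ surface_measure
  surface_measure0 surface_measure_ge0 surface_measure_sigma_additive.

End sphere.
Arguments sphere : clear implicits.
Arguments surface_measure : clear implicits.

Definition orthogonal_group (R : realType) (n : nat) : set 'M[R]_n :=
  [set A | A *m A^T = 1%:M].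
Arguments orthogonal_group : clear implicits.

(* [wt_sum] forces [npts] to be positive. *)
Record cloud (R : realType) (n : nat) := Cloud {
  npts : nat;
  pt : 'I_npts -> 'rV[R]_n;
  wt : 'I_npts -> R;
  wt_gt0 : forall i, 0 < wt i;
  wt_sum : \sum_i wt i = 1;
  pt_inj : injective pt }.
Arguments pt {R n} _ _.
Arguments wt {R n} _ _.

HB.instance Definition _ (R : realType) (n : nat) := gen_eqMixin (cloud R n).
HB.instance Definition _ (R : realType) (n : nat) := gen_choiceMixin (cloud R n).

Section rswd.
Context {R : realType} {n : nat}.
Implicit Types P Q : cloud R n.

Definition cloud_equiv P Q : Prop :=
  exists (e : npts P = npts Q) (A : 'M[R]_n) (s : 'S_(npts P)),
    orthogonal_group R n A /\
    forall i, pt P i *m A = pt Q (cast_ord e (s i)) /\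
              wt P i = wt Q (cast_ord e (s i)).

(* The least element of A, with default value 0 if A has none. *)
Definition minimum (A : set R) : R := xget 0 (A `&` lbound A).

(* A plan between the projected measures is represented by its matrix of
   weights, so that the set of plans does not depend on the projections. *)
Definition transport_plans P Q : set 'M[R]_(npts P, npts Q) :=
  [set sigma | [/\ forall i j, 0 <= sigma i j,
                   forall i, \sum_j sigma i j = wt P i &
                   forall j, \sum_i sigma i j = wt Q j]].

Arguments transport_plans : clear implicits.

Definition sliced_cost P Q (A : 'M[R]_n) (theta : 'rV[R]_n)
    (sigma : 'M[R]_(npts P, npts Q)) : R :=
  \sum_i \sum_j
    sigma i j * `|edot (pt P i *m A) theta - edot (pt Q j) theta| ^+ 2.

Definition sliced_W2_sq P Q (A : 'M[R]_n) (theta : 'rV[R]_n) : R :=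
  minimum [set sliced_cost A theta sigma | sigma in transport_plans P Q].

Definition RSWD_sq P Q : R :=
  minimum
    [set \int[surface_measure R n]_(theta in sphere R n) sliced_W2_sq P Q A theta
    | A in orthogonal_group R n].

Definition RSWD P Q : R := Num.sqrt (RSWD_sq P Q).

Lemma cloud_equiv_refl P : cloud_equiv P P.
Proof.
exists erefl, 1%:M, 1%g; split; first by rewrite /orthogonal_group/= trmx1 mul1mx.
by move=> i; rewrite cast_ord_id perm1 mulmx1.
Qed.

Lemma cloud_equiv_sym P Q : cloud_equiv P Q -> cloud_equiv Q P.
Proof.
case: P Q => [l p w w0 w1 pI] [l' q u u0 u1 qI].
move=> [/= e]; case: l' / e q u u0 u1 qI => q u u0 u1 qI [A [s [/= AO H]]].
exists erefl, A^T, s^-1%g; split.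
  by rewrite /orthogonal_group/= trmxK; exact: mulmx1C.
move=> i; have [] /= := H (s^-1%g i); rewrite !cast_ord_id permKV => <- <-.
by rewrite -mulmxA AO mulmx1.
Qed.

Lemma cloud_equiv_trans P Q S :
  cloud_equiv P Q -> cloud_equiv Q S -> cloud_equiv P S.
Proof.
case: P Q S => [l p w w0 w1 pI] [l' q u u0 u1 qI] [l'' r x x0 x1 rI].
move=> [/= e]; case: l' / e q u u0 u1 qI => q u u0 u1 qI [A [s [/= AO H]]].
move=> [/= e]; case: l'' / e r x x0 x1 rI => r x x0 x1 rI [B [t [/= BO K]]].
exists erefl, (A *m B), (s * t)%g; split.
  by rewrite /orthogonal_group/= trmx_mul mulmxA -(mulmxA A) BO mulmx1.
move=> i; have [] /= := H i; have [] /= := K (s i).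
rewrite !cast_ord_id permM => <- <- <- ->.
by rewrite mulmxA.
Qed.

Definition cloud_equivb : rel (cloud R n) := fun P Q => `[< cloud_equiv P Q >].

Lemma cloud_equivb_refl : reflexive cloud_equivb.
Proof. by move=> P; apply/asboolP; exact: cloud_equiv_refl. Qed.

Lemma cloud_equivb_sym : symmetric cloud_equivb.
Proof.
by move=> P Q; apply/asboolP/asboolP; exact: cloud_equiv_sym.
Qed.

Lemma cloud_equivb_trans : transitive cloud_equivb.
Proof.
move=> Q P S /asboolP PQ /asboolP QS; apply/asboolP.
exact: cloud_equiv_trans PQ QS.
Qed.

Canonical cloud_equiv_rel := EquivRel cloud_equivb
  cloud_equivb_refl cloud_equivb_sym cloud_equivb_trans.

End rswd.

Definition cloud_quotient (R : realType) (n : nat) : Type :=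
  {eq_quot @cloud_equiv_rel R n}.

Definition is_metric (R : realType) (T : Type) (d : T -> T -> R) : Prop :=
  [/\ forall x y, 0 <= d x y,
      forall x y, d x y = 0 <-> x = y,
      forall x y, d x y = d y x &
      forall x y z, d x y <= d x z + d z y].

(* Main.v *)
Require Import Defs.
From HB Require Import structures.
From mathcomp Require Import all_boot all_order all_algebra all_fingroup.
From mathcomp Require Import generic_quotient.
From mathcomp Require Import all_classical all_reals all_analysis.
From mathcomp Require Import measurable_realfun ring lra.

(** Write W2(A, theta) for the squared Wasserstein distance between the
projections on theta of the cloud P rotated by A and of Q, and F(A) for its
integral over the sphere ([aligned_cost]), so that RSWD^2 is the minimum of F
over O(n).

Both minima in the definition are attained.  The transport plans and the
orthogonal matrices are compact sets of matrices.  The cost of a plan is linear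
in the plan, and F is Lipschitz on O(n) because the value of a finite transport
problem is Lipschitz in its cost matrix ([transport_value_lipschitz]).  The same
Lipschitz bound makes theta |-> W2(A, theta) measurable.

The surface measure is invariant under O(n) ([surface_measure_orthogonal]).
By the cone formula that defines it, this is the invariance of Lebesgue measure
on R^n ([lebesgue_rV_orthogonal]), which follows from translation invariance and
Fubini: the usual proof of the uniqueness of Haar measure, applied to the ball,
which is itself invariant.

Symmetry: rotating theta turns the problem from Q to P with the matrix A^T into
the one from P to Q with A, up to transposing the plans.

Triangle inequality: if A is optimal from P to S, and B from S to Q, use A B from
P to Q.  For 0 < t < 1, the inequality (x - z)^2 <= (x - y)^2 / t +
(y - z)^2 / (1 - t) passes through the gluing of plans and the integral over the
sphere, whence RSWD(P, Q)^2 <= a^2 / t + b^2 / (1 - t) with a = RSWD(P, S) and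
b = RSWD(S, Q) ([aligned_cost_glue]).  Taking t = a / (a + b) gives (a + b)^2.
Keeping t free until the end replaces Minkowski's inequality both for the plans
and for the integral.

Definiteness: if F(A) = 0, then W2(A, theta) = 0 for almost every theta.
Hyperplanes are null, so some such theta is orthogonal to no nonzero difference
p_i A - q_j.  A plan of zero cost at this theta moves mass only between points
with p_i A = q_j; as the points of a cloud are distinct, it is the graph of a
weight-preserving bijection.  Conversely the graph of an equivalence is a plan of
cost zero.  Invariance under the equivalence, hence the metric on the quotient,
then follows from the triangle inequality. *)

Set Implicit Arguments.
Unset Strict Implicit.
Unset Printing Implicit Defensive.
Import Order.TTheory GRing.Theory Num.Theory.
Import numFieldNormedType.Exports.
Local Open Scope classical_set_scope.
Local Open Scope ring_scope.
Local Open Scope quotient_scope.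

(** * Lebesgue measure on row vectors *)

Lemma measurable_preimage d1 d2 (T1 : measurableType d1) (T2 : measurableType d2)
    (f : T1 -> T2) (B : set T2) :
  measurable_fun setT f -> measurable B -> measurable (f @^-1` B).
Proof. by move=> mf mB; rewrite -[X in measurable X]setTI; exact: mf. Qed.

Section lebesgue_translation.
Context {R : realType}.

Lemma lebesgue_measure_translate (a : R) (B : set (measurableTypeR R)) :
  measurable B ->
  lebesgue_measure ((fun x : measurableTypeR R => (x + a : measurableTypeR R)) @^-1` B)
  = lebesgue_measure B.
Proof.
have ma : measurable_fun setT (fun x : measurableTypeR R => (x + a : measurableTypeR R)).
  exact: measurable_funD.
move=> mB; rewrite -[LHS]/(pushforward lebesgue_measure _ B).
apply/esym/lebesgue_measure_unique => //= _ [[u v]] _ <-.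
rewrite /pushforward (_ : _ @^-1` _ = `]u - a, v - a]%classic).
  rewrite !lebesgue_measure_itv/= !lte_fin ltrD2r -!EFinD.
  by rewrite opprD opprK addrACA addNr addr0.
by apply/seteqP; split => x /=; rewrite !in_itv/= ltrBlDr lerBrDr.
Qed.

Lemma rV_unconsK n : cancel (@rV_uncons R n) rV_cons.
Proof.
move=> v; apply/rowP => i; case: (splitP (i : 'I_(1 + n))) => [j ij|k ik].
  have -> : i = lshift n j by exact/val_inj.
  by rewrite rV_cons_head (ord1 j) /=; congr (v _ _); exact/val_inj.
have -> : i = rshift 1 k by exact/val_inj.
by rewrite rV_cons_tail /= mxE.
Qed.

Lemma rV_consD n (p q : measurableTypeR R * 'rV[R]_n) :
  rV_cons p + rV_cons q = rV_cons ((p.1 + q.1 : R), p.2 + q.2).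
Proof.
apply/rowP => i; rewrite mxE; case: (splitP (i : 'I_(1 + n))) => [j ij|k ik].
  have -> : i = lshift n j by exact/val_inj.
  by rewrite !rV_cons_head.
have -> : i = rshift 1 k by exact/val_inj.
by rewrite !rV_cons_tail mxE.
Qed.

Lemma edot_rV_cons n (p q : measurableTypeR R * 'rV[R]_n) :
  edot (rV_cons p) (rV_cons q) = (p.1 : R) * (q.1 : R) + edot p.2 q.2.
Proof.
rewrite /edot mxE big_ord_recl [X in _ = _ + X]mxE; congr (_ + _).
  have hd r : rV_cons r ord0 ord0 = r.1 :> R.
    by rewrite -{1}(rV_cons_head r ord0); congr (_ _ _); exact: val_inj.
  by rewrite [X in _ * X]mxE !hd.
apply: eq_bigr => k _; have -> : lift ord0 k = rshift 1 k by exact/val_inj.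
by rewrite [X in _ * X = _]mxE [X in _ = _ * X]mxE !rV_cons_tail.
Qed.

(** The recursive definition of [lebesgue_rV], read as an iterated integral: the
form suited to induction on the dimension. *)
Lemma lebesgue_rVS n (B : set 'rV[R]_n.+1) :
  lebesgue_rV R n.+1 B = (\int[lebesgue_measure]_x
     lebesgue_rV R n [set v | B (rV_cons (x, v))])%E.
Proof.
apply: eq_integral => x _ /=; congr (lebesgue_rV R n _).
by apply/seteqP; split => v; rewrite /xsection /= inE.
Qed.

Lemma measurable_slice n (B : set 'rV[R]_n.+1) (x : measurableTypeR R) :
  measurable B -> measurable [set v : 'rV[R]_n | B (rV_cons (x, v))].
Proof.
move=> mB; apply: (@measurable_preimage _ _ _ _ (fun v => rV_cons (x, v))) => //.
exact: (measurableT_comp measurable_rV_cons (measurable_pair1 _)).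
Qed.

Lemma measurable_fun_slice n (B : set 'rV[R]_n.+1) : measurable B ->
  measurable_fun setT (fun x : measurableTypeR R =>
    lebesgue_rV R n [set v | B (rV_cons (x, v))]).
Proof.
move=> mB; have mB' := measurable_preimage measurable_rV_cons mB.
have := measurable_fun_xsection (lebesgue_rV R n) mB'.
apply: eq_measurable_fun => x _ /=; congr (lebesgue_rV R n _).
by apply/seteqP; split => v; rewrite /xsection /= inE.
Qed.

(** Fubini: translating by (a0, a') translates the slice at x + a0 by a' and the
variable x by a0. *)
Lemma lebesgue_rV_translate n (a : 'rV[R]_n) (B : set 'rV[R]_n) :
  measurable B -> lebesgue_rV R n [set v | B (v + a)] = lebesgue_rV R n B.
Proof.
elim: n => [|n IH] in a B * => mB.
  by congr (lebesgue_rV R 0 _); apply/seteqP; split => v /=; rewrite !thinmx0.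
rewrite !lebesgue_rVS.
pose g (x : measurableTypeR R) := lebesgue_rV R n [set v | B (rV_cons (x, v))].
have mg : measurable_fun setT g by exact: measurable_fun_slice.
pose a0 : measurableTypeR R := (rV_uncons a).1.
have ma : measurable_fun setT (fun x : measurableTypeR R => (x + a0 : R) : measurableTypeR R).
  exact: measurable_funD.
transitivity (\int[lebesgue_measure]_x (g ((x : R) + a0)%R))%E.
  apply: eq_integral => x _; rewrite /g -[RHS](IH (rV_uncons a).2); last exact: measurable_slice.
  congr (lebesgue_rV R n _); apply/seteqP.
  have E v : rV_cons (x, v) + a = rV_cons (((x : R) + a0)%R, v + (rV_uncons a).2).
    by rewrite -[in LHS](rV_unconsK a) rV_consD.
  by split => v /=; rewrite E.
rewrite -[LHS](@ge0_integral_pushforward _ _ _ _ _ _ ma lebesgue_measure setT g)//=.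
by apply: eq_measure_integral => A mA _; exact: lebesgue_measure_translate.
Qed.

Lemma measurable_box n (a b : R) :
  measurable [set v : 'rV[R]_n | forall i, a < v ord0 i <= b].
Proof.
rewrite (_ : [set _ | _] = \bigcap_(i in [set: 'I_n])
    (fun v : 'rV[R]_n => v ord0 i) @^-1` `]a, b]%classic).
  apply: fin_bigcap_measurable => // i _.
  by apply: measurable_preimage; [exact: measurable_coord | exact: measurable_itv].
apply/seteqP; split => v /=.
  by move=> H i _; rewrite /= in_itv/= H.
by move=> H i; have := H i I; rewrite /= in_itv.
Qed.

(** Boxes are what bounds the measure of the ball away from 0 and infinity. *)
Lemma lebesgue_rV_box n (a b : R) : a < b ->
  lebesgue_rV R n [set v | forall i, a < v ord0 i <= b] = ((b - a) ^+ n)%:E.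
Proof.
move=> ab; elim: n => [|n IH].
  by rewrite /= diracE expr0 mem_set // => -[].
rewrite -[LHS]/((lebesgue_measure \x lebesgue_rV R n)%E (rV_cons @^-1` _)).
rewrite (_ : rV_cons @^-1` _ = 
    (`]a, b]%classic : set (measurableTypeR R)) `*`
    [set v : 'rV[R]_n | forall i, a < v ord0 i <= b]).
  rewrite product_measure1E//; last exact: measurable_box.
  have L : lebesgue_measure (`]a, b]%classic : set R) = (b - a)%:E.
    by rewrite lebesgue_measure_itv/= lte_fin ab.
  by rewrite exprS EFinM; congr (_ * _)%E; [exact: L | exact: IH].
apply/seteqP; split => -[x v] /=.
  move=> H; split => [|i].
    by have := H (lshift n (ord0 : 'I_1)); rewrite rV_cons_head /= in_itv.
  by have := H (rshift 1 i); rewrite rV_cons_tail.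
rewrite in_itv /= => -[Hx Hv] i; case: (splitP (i : 'I_(1 + n))) => [j ij|k ik].
  have -> : i = lshift n j by exact/val_inj.
  by rewrite rV_cons_head.
have -> : i = rshift 1 k by exact/val_inj.
by rewrite rV_cons_tail.
Qed.

(** Cut the hyperplane at the first coordinate.  If a has a nonzero tail, every
slice is an affine hyperplane of lower dimension, which is why c is arbitrary;
otherwise only one slice is nonempty. *)
Lemma lebesgue_rV_hyperplane n (a : 'rV[R]_n) (c : R) :
  a != 0 -> lebesgue_rV R n [set v | edot a v = c] = 0%E.
Proof.
elim: n => [|n IH] in a c *; first by rewrite thinmx0 eqxx.
move=> a0; rewrite lebesgue_rVS -(rV_unconsK a).
set p := rV_uncons a.
have [p20|p20] := eqVneq p.2 0; last first.
  apply: integral0_eq => x _; rewrite -(IH p.2 (c - p.1 * x) p20).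
  congr (lebesgue_rV R n _); apply/seteqP; split => v /=; rewrite edot_rV_cons /=.
    by move=> <-; rewrite addrAC subrr add0r.
  by move=> ->; rewrite addrCA subrr addr0.
have p10 : (p.1 : R) != 0.
  apply: contraNneq a0 => p10; rewrite -(rV_unconsK a) -/p (surjective_pairing p) p20 p10.
  by rewrite /rV_cons /= raddf0 row_mx0.
rewrite (eq_integral (fun x : measurableTypeR R =>
    (\1_[set (c / p.1 : measurableTypeR R)] x)%:E * lebesgue_rV R n setT)%E); last first.
  move=> x _; rewrite indicE.
  have [/set_mem /= ->|/negP xc] := boolP (x \in _).
    rewrite mul1e; congr (lebesgue_rV R n _); apply/seteqP; split => v //= _.
    by rewrite edot_rV_cons p20 /edot mul0mx mxE addr0 mulrCA divff// mulr1.
  rewrite mul0e -[RHS](measure0 (lebesgue_rV R n)); congr (lebesgue_rV R n _).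
  apply/seteqP; split => v //=.
  rewrite edot_rV_cons p20 /edot mul0mx mxE addr0 /= => H.
  by apply: xc; rewrite inE /= -H mulrAC divff// mul1r.
rewrite ge0_integralZr//; last exact: measurableT_comp.
by rewrite integral_indic// setIT [X in (X * _)%E](lebesgue_measure_set1 (c / p.1)) mul0e.
Qed.

End lebesgue_translation.
(** * Euclidean geometry of row vectors *)

Section euclidean.
Context {R : realType} {n : nat}.
Implicit Types (u v : 'rV[R]_n) (A : 'M[R]_n).

Lemma edotE u v : edot u v = \sum_i u ord0 i * v ord0 i.
Proof. by rewrite /edot mxE; apply: eq_bigr => i _; rewrite mxE. Qed.

Lemma edotC u v : edot u v = edot v u.
Proof. by rewrite !edotE; apply: eq_bigr => i _; rewrite mulrC. Qed.

Lemma edotDl u1 u2 v : edot (u1 + u2) v = edot u1 v + edot u2 v.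
Proof. by rewrite /edot mulmxDl mxE. Qed.

Lemma edotNl u v : edot (- u) v = - edot u v.
Proof. by rewrite /edot mulNmx mxE. Qed.

Lemma edotZl c u v : edot (c *: u) v = c * edot u v.
Proof. by rewrite /edot -scalemxAl mxE. Qed.

Lemma edotZr c u v : edot u (c *: v) = c * edot u v.
Proof. by rewrite edotC edotZl edotC. Qed.

Lemma edot_mulmx u v A : edot (u *m A) v = edot u (v *m A^T).
Proof. by rewrite /edot trmx_mul trmxK mulmxA. Qed.

Lemma edot_ge0 v : 0 <= edot v v.
Proof. by rewrite edotE sumr_ge0// => i _; rewrite -expr2 sqr_ge0. Qed.

Lemma sqr_enorm v : enorm v ^+ 2 = edot v v.
Proof. by rewrite sqr_sqrtr// edot_ge0. Qed.

Lemma enorm_ge0 v : 0 <= enorm v.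
Proof. exact: sqrtr_ge0. Qed.

Lemma coord_le_enorm v i : `|v ord0 i| <= enorm v.
Proof.
rewrite -(ler_pXn2r (isT : (0 < 2)%N)) ?nnegrE ?enorm_ge0// sqr_enorm real_normK ?num_real//.
rewrite edotE (bigD1 i)//= -expr2 lerDl sumr_ge0// => j _.
by rewrite -expr2 sqr_ge0.
Qed.

Lemma enormN v : enorm (- v) = enorm v.
Proof. by rewrite /enorm edotNl edotC edotNl opprK. Qed.

Lemma enormZ c v : enorm (c *: v) = `|c| * enorm v.
Proof.
by rewrite /enorm edotZl edotZr mulrA -expr2 sqrtrM ?sqr_ge0// sqrtr_sqr.
Qed.

Lemma orthogonal_trmx A : orthogonal_group R n A -> orthogonal_group R n A^T.
Proof. by rewrite /orthogonal_group /= trmxK; exact: mulmx1C. Qed.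

Lemma orthogonal_mulmx A B : orthogonal_group R n A ->
  orthogonal_group R n B -> orthogonal_group R n (A *m B).
Proof.
rewrite /orthogonal_group /= => AO BO.
by rewrite trmx_mul mulmxA -(mulmxA A) BO mulmx1.
Qed.

Lemma orthogonal1 : orthogonal_group R n 1%:M.
Proof. by rewrite /orthogonal_group/= trmx1 mul1mx. Qed.

Lemma enorm_orthogonal A v : orthogonal_group R n A -> enorm (v *m A) = enorm v.
Proof. by move=> AO; rewrite /enorm edot_mulmx -mulmxA AO mulmx1. Qed.

Lemma punctured_ball_orthogonal A v : orthogonal_group R n A ->
  punctured_ball (v *m A) <-> punctured_ball v.
Proof. by move=> AO; rewrite /punctured_ball /= enorm_orthogonal. Qed.

Lemma normalize_orthogonal A v : orthogonal_group R n A ->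
  normalize (v *m A) = normalize v *m A.
Proof. by move=> AO; rewrite /normalize enorm_orthogonal// scalemxAl. Qed.

Lemma normalize_sphere v : 0 < enorm v -> sphere R n (normalize v).
Proof.
move=> v0; rewrite /sphere /= /normalize enormZ ger0_norm ?invr_ge0 ?enorm_ge0//.
by rewrite mulVf// gt_eqF.
Qed.

Lemma measurable_mulmxr A : measurable_fun setT (fun v : 'rV[R]_n => v *m A).
Proof.
apply/measurable_fun_coordP => i.
rewrite (_ : (fun _ => _) = (fun v : 'rV[R]_n => \sum_j v ord0 j * A j i)); last first.
  by apply/funext => v; rewrite mxE.
apply: measurable_sum => j; apply: measurable_funM => //.
exact: measurable_coord.
Qed.

Lemma measurable_edot u : measurable_fun setT (fun v => edot u v).
Proof.
rewrite (_ : (fun _ => _) = (fun v : 'rV[R]_n => \sum_j u ord0 j * v ord0 j)).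
  apply: measurable_sum => j; apply: measurable_funM => //.
  exact: measurable_coord.
by apply/funext => v; rewrite edotE.
Qed.

Lemma measurable_sphere : measurable (sphere R n).
Proof.
rewrite (_ : sphere R n = enorm @^-1` [set 1])//.
by apply: measurable_preimage => //; exact: measurable_enorm.
Qed.

End euclidean.

(** * Orthogonal invariance of Lebesgue and surface measures *)

Section rotation.
Context {R : realType} {n : nat}.
Context (n_gt0 : (0 < n)%N).
Notation L := (lebesgue_rV R n).
Notation ball := (@punctured_ball R n).

(** The ball contains the box of the vectors with coordinates in ]0, 1/n]. *)
Lemma lebesgue_punctured_ball_gt0 : (0 < L ball)%E.
Proof.
have n0 : (0 : R) < n%:R by rewrite ltr0n.
have n1 : (n%:R^-1 : R) <= 1 by rewrite invf_le1// ler1n.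
have ni0 : (0 : R) < n%:R^-1 by rewrite invr_gt0.
apply: (@lt_le_trans _ _ (L [set v | forall i, 0 < v ord0 i <= n%:R^-1])).
  by rewrite lebesgue_rV_box// subr0 lte_fin exprn_gt0.
apply: le_measure; rewrite ?inE; [exact: measurable_box | exact: measurable_punctured_ball |].
move=> v /= Hv; rewrite /punctured_ball /= /enorm.
have ev0 : 0 < edot v v.
  rewrite edotE (bigD1 (Ordinal n_gt0))//= ltr_pwDl//.
    by rewrite mulr_gt0//; have /andP[] := Hv (Ordinal n_gt0).
  by rewrite sumr_ge0// => j _; rewrite -expr2 sqr_ge0.
rewrite sqrtr_gt0 ev0 /= -sqrtr1 ler_wsqrtr// edotE.
apply: (@le_trans _ _ (\sum_(i < n) n%:R^-1)).
  apply: ler_sum => i _; have /andP[vi0 vi1] := Hv i.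
  by rewrite -[leRHS]mulr1; apply: ler_pM => //; [exact: ltW | exact: ltW | exact: le_trans vi1 n1].
by rewrite sumr_const card_ord -[X in X <= _]mulr_natr mulVf ?gt_eqF.
Qed.

Lemma lebesgue_punctured_ball_lty : (L ball < +oo)%E.
Proof.
apply: (@le_lt_trans _ _ (L [set v | forall i, -2 < v ord0 i <= 1])).
  apply: le_measure; rewrite ?inE; [exact: measurable_punctured_ball | exact: measurable_box |].
  move=> v /andP[_ v1] i.
  have := le_trans (coord_le_enorm v i) v1; rewrite ler_norml => /andP[h ->].
  by rewrite andbT (lt_le_trans _ h)// ltrN2 ltr1n.
by rewrite lebesgue_rV_box ?ltry//; lra.
Qed.

Lemma measurable_affine_pair (A B : 'M[R]_n) :
  measurable_fun setT (fun p : 'rV[R]_n * 'rV[R]_n => p.1 *m A + p.2 *m B).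
Proof.
apply/measurable_fun_coordP => i.
rewrite (_ : (fun _ => _) = (fun p : 'rV[R]_n * 'rV[R]_n => (p.1 *m A) ord0 i + (p.2 *m B) ord0 i)).
  apply: measurable_funD.
    exact: (measurableT_comp (measurable_coord i)
      (measurableT_comp (measurable_mulmxr A) measurable_fst)).
  exact: (measurableT_comp (measurable_coord i)
      (measurableT_comp (measurable_mulmxr B) measurable_snd)).
by apply/funext => v; rewrite mxE.
Qed.

Lemma fubini_set (E : set ('rV[R]_n * 'rV[R]_n)) : measurable E ->
  (\int[L]_x L [set y | E (x, y)] = \int[L]_y L [set x | E (x, y)])%E.
Proof.
move=> mE.
have := @product_measure_unique _ _ _ _ _ L L (L \x^ L)%E
  (fun A B mA mB => product_measure2E L L mA mB) E mE.
rewrite /product_measure1 /= /product_measure2 => H.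
transitivity (\int[L]_x L (xsection E x))%E.
  apply: eq_integral => x _; congr (L _).
  by apply/seteqP; split => y; rewrite /xsection /= inE.
rewrite [LHS]H; apply: eq_integral => x _; congr (L _).
by apply/seteqP; split => y; rewrite /ysection /= inE.
Qed.

Lemma integral_indic_cst (B : set 'rV[R]_n) (F : 'rV[R]_n -> set 'rV[R]_n) c :
  measurable B -> (forall x, B x -> L (F x) = c) ->
  (\int[L]_x L [set y | B x /\ F x y] = L B * c)%E.
Proof.
move=> mB Fc.
have [[x0 Bx0]|B0] := pselect (exists x, B x); last first.
  rewrite (_ : B = set0) ?measure0 ?mul0e; last first.
    by apply/seteqP; split => // x Bx; apply: B0; exists x.
  apply: integral0_eq => x _; rewrite -[RHS](measure0 L); congr (L _).
  by apply/seteqP; split => // y [].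
have c0 : (0 <= c)%E by rewrite -(Fc _ Bx0).
rewrite (eq_integral (fun x => (\1_B x)%:E * c)%E).
  rewrite ge0_integralZr//; last exact: measurableT_comp.
  by rewrite integral_indic// setIT.
move=> x _; rewrite indicE; have [/set_mem Bx|/negP Bx] := boolP (x \in B).
  rewrite mul1e -(Fc _ Bx); congr (L _).
  by apply/seteqP; split => [y []|y Fy] //; split.
rewrite mul0e -[RHS](measure0 L); congr (L _).
by apply/seteqP; split => // y [] Bx'; exfalso; apply: Bx; rewrite inE.
Qed.

(** Let T v = v A and let B be the ball.  Translating y shows that
{(x, y) : x in B, T x + y in C} has measure L(B) L(C).  Translating x by
T^-1 y instead turns this set into {x - T^-1 y in B, T x in C}; since B is
invariant under T and under -1, integrating over y first gives
L(T^-1 C) L(B).  As 0 < L(B) < oo, it can be cancelled. *)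
Lemma lebesgue_rV_orthogonal (A : 'M[R]_n) (C : set 'rV[R]_n) :
  orthogonal_group R n A -> measurable C -> L [set v | C (v *m A)] = L C.
Proof.
move=> AO mC.
have AO' : A^T *m A = 1%:M by exact: mulmx1C.
have mB : measurable ball := measurable_punctured_ball.
have mCA : measurable [set v | C (v *m A)].
  by apply: (@measurable_preimage _ _ _ _ (fun v => v *m A)) => //; exact: measurable_mulmxr.
pose E := [set p : 'rV[R]_n * 'rV[R]_n | ball p.1 /\ C (p.1 *m A + p.2)].
have mE : measurable E.
  apply: measurableI.
    exact: measurable_preimage measurable_fst mB.
  have := measurable_preimage (measurable_affine_pair A 1%:M) mC.
  by congr measurable; apply/seteqP; split => p /=; rewrite mulmx1.
pose E' := [set p : 'rV[R]_n * 'rV[R]_n | C (p.1 *m A) /\ ball (p.1 - p.2 *m A^T)].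
have mE' : measurable E'.
  apply: measurableI.
    exact: measurable_preimage measurable_fst mCA.
  have := measurable_preimage (measurable_affine_pair 1%:M (- A^T)) mB.
  by congr measurable; apply/seteqP; split => p /=; rewrite mulmx1 mulmxN.
have e1 : (\int[L]_x L [set y | E (x, y)] = L ball * L C)%E.
  apply: (integral_indic_cst (B := ball) (F := fun x => [set y | C (x *m A + y)])) => // x _.
  rewrite -[RHS](lebesgue_rV_translate (x *m A) mC).
  by congr (L _); apply/seteqP; split => y /=; rewrite addrC.
have e2 : (\int[L]_x L [set y | E' (x, y)] = L [set v | C (v *m A)] * L ball)%E.
  apply: (integral_indic_cst (B := [set v | C (v *m A)])
    (F := fun x => [set y | ball (x - y *m A^T)])) => // x _.
  rewrite -[RHS](lebesgue_rV_translate (- (x *m A)) mB).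
  have H y : ball (x - y *m A^T) <-> ball (y - x *m A).
    rewrite -(punctured_ball_orthogonal _ AO) mulmxBl -mulmxA AO' mulmx1.
    by rewrite /punctured_ball /= -enormN opprB.
  by congr (L _); apply/seteqP; split => y /= /H.
have e3 : (\int[L]_x L [set y | E (x, y)] = \int[L]_x L [set y | E' (x, y)])%E.
  rewrite !fubini_set//; apply: eq_integral => y _.
  have mEy : measurable [set x | E (x, y)].
    exact: (@measurable_preimage _ _ _ _ (fun x => (x, y)) _ (measurable_pair2 y)).
  rewrite -(lebesgue_rV_translate (- (y *m A^T)) mEy); congr (L _).
  have H x : (x - y *m A^T) *m A + y = x *m A.
    by rewrite mulmxBl -mulmxA AO' mulmx1 subrK.
  by apply/seteqP; split => x; rewrite /E /E' /= H => -[].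
have ballfin : L ball \is a fin_num by rewrite ge0_fin_numE// lebesgue_punctured_ball_lty.
have ball0 := lebesgue_punctured_ball_gt0.
move: e3; rewrite e1 e2 muleC => e3; apply/eqP; rewrite eq_le.
by rewrite -(lee_pmul2r ballfin ball0) -[X in _ && X](lee_pmul2r ballfin ball0) e3 lexx.
Qed.

Lemma surface_measureE (B : set 'rV[R]_n) :
  surface_measure R n B = (n%:R%:E * L (ball `&` [set v | B (normalize v)]))%E.
Proof. by rewrite setIC. Qed.

Lemma surface_measure_orthogonal (A : 'M[R]_n) (C : set 'rV[R]_n) :
  orthogonal_group R n A -> measurable C ->
  surface_measure R n [set v | C (v *m A)] = surface_measure R n C.
Proof.
move=> AO mC; rewrite !surface_measureE; congr (_ * _)%E.
rewrite -[RHS](lebesgue_rV_orthogonal AO).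
  congr (L _); apply/seteqP; split => v /= [bv Cv]; split.
  - exact: (punctured_ball_orthogonal v AO).2.
  - by rewrite normalize_orthogonal.
  - exact: (punctured_ball_orthogonal v AO).1.
  - by rewrite -normalize_orthogonal.
apply: measurableI; first exact: measurable_punctured_ball.
exact: (measurable_preimage measurable_normalize mC).
Qed.

Lemma surface_measure_lty (B : set 'rV[R]_n) : measurable B ->
  (surface_measure R n B < +oo)%E.
Proof.
move=> mB; rewrite surface_measureE lte_mul_pinfty ?lee_fin//.
apply: le_lt_trans lebesgue_punctured_ball_lty.
apply: le_measure; rewrite ?inE; [|exact: measurable_punctured_ball|by move=> ? []].
apply: measurableI; first exact: measurable_punctured_ball.
exact: (measurable_preimage measurable_normalize mB).
Qed.

Lemma surface_measure_sphere_gt0 : (0 < surface_measure R n (sphere R n))%E.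
Proof.
rewrite surface_measureE mule_gt0 ?lte_fin ?ltr0n//.
rewrite (_ : _ `&` _ = ball) ?lebesgue_punctured_ball_gt0//.
apply/seteqP; split => [v []//|v bv]; split => //.
by apply: normalize_sphere; case/andP: bv.
Qed.

(** A linear hyperplane is a cone, so the cone formula reduces this to Lebesgue
measure. *)
Lemma surface_measure_hyperplane (a : 'rV[R]_n) : a != 0 ->
  surface_measure R n [set v | edot a v = 0] = 0%E.
Proof.
move=> a0; rewrite surface_measureE.
have mH : measurable [set v | edot a v = 0].
  by apply: (@measurable_preimage _ _ _ _ (edot a) [set 0]) => //; exact: measurable_edot.
apply/eqP; rewrite mule_eq0; apply/orP; right; rewrite -measure_le0.
rewrite -(lebesgue_rV_hyperplane 0 a0); apply: le_measure; rewrite ?inE//.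
  apply: measurableI; first exact: measurable_punctured_ball.
  exact: (measurable_preimage measurable_normalize mH).
move=> v [/andP[v0 _]] /=; rewrite edotZr => /eqP; rewrite mulf_eq0 invr_eq0 gt_eqF//=.
by move=> /eqP.
Qed.

Lemma surface_integral_orthogonal (A : 'M[R]_n) (f : 'rV[R]_n -> R) :
  orthogonal_group R n A -> measurable_fun setT f -> (forall v, 0 <= f v) ->
  \int[surface_measure R n]_(v in sphere R n) f (v *m A) =
  \int[surface_measure R n]_(v in sphere R n) f v.
Proof.
move=> AO mf f0; rewrite /Rintegral; congr fine.
have mA := measurable_mulmxr A.
transitivity (\int[pushforward (surface_measure R n) (fun v => v *m A)]_(v in sphere R n)
    (f v)%:E)%E.
  rewrite (ge0_integral_pushforward mA).
  - congr (integral _ _ _); apply/seteqP; split => v; by rewrite /sphere/= enorm_orthogonal.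
  - exact: measurable_sphere.
  - by apply/measurable_EFinP; exact: measurable_funTS.
  - by move=> y _; rewrite lee_fin.
by apply: eq_measure_integral => B mB _; exact: surface_measure_orthogonal.
Qed.

End rotation.
(** * Minima over compact sets of matrices *)

Section extreme_values.
Context {R : realType}.

(** The default value in [minimum] is harmless once a least element is known. *)
Lemma minimumE (A : set R) (m : R) : A m -> lbound A m -> minimum A = m.
Proof.
move=> Am lbm; rewrite /minimum.
have [_ H] := xgetPex 0 (ex_intro (A `&` lbound A) m (conj Am lbm)).
have [Ax _] := xgetPex 0 (ex_intro (A `&` lbound A) m (conj Am lbm)).
by apply/eqP; rewrite eq_le H//= lbm.
Qed.

Lemma continuous_sum (T : topologicalType) (I : finType) (f : I -> T -> R) :
  (forall i, continuous (f i)) -> continuous (fun x => \sum_i f i x).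
Proof.
by move=> cf; apply: continuous_big => // -[x y]; exact: cvgD cvg_fst cvg_snd.
Qed.

Lemma vec_mx_continuous m p : continuous (@vec_mx R m p).
Proof.
move=> x U [P HP PU].
have near_coord i j : \forall y \near (x : 'rV[R]_(m * p)), P i j (vec_mx y i j).
  have cP : \forall y \near (x : 'rV[R]_(m * p)),
      P i j ((y : 'rV[R]_(m * p)) ord0 (mxvec_index i j)).
    by apply: (@coord_continuous R _ _ ord0 (mxvec_index i j) x); have := HP i j; rewrite mxE.
  by near=> y; rewrite mxE; near: y.
have : \forall y \near (x : 'rV[R]_(m * p)), forall i j, P i j (vec_mx y i j).
  apply: (@filter_forall _ _ _ _ (nbhs_filter x)) => i.
  by apply: (@filter_forall _ _ _ _ (nbhs_filter x)) => j; exact: near_coord.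
by apply: filterS => y Hy; exact: PU.
Unshelve. all: by end_near. Qed.

(** The bound 1 fits both uses: transport plans and orthogonal matrices
have entries in [-1, 1].  Compactness is Tychonoff's theorem for row vectors,
transported by [vec_mx]. *)
Lemma compact_bounded_mx m p (K : set 'M[R]_(m, p)) :
  closed K -> (forall x, K x -> forall i j, `|x i j| <= 1) -> compact K.
Proof.
move=> cK K1.
have -> : K = vec_mx @` (vec_mx @^-1` K).
  apply/seteqP; split => [x Kx|_ [v Kv <-]//].
  by exists (mxvec x); rewrite /= mxvecK.
apply: continuous_compact; first exact/continuous_subspaceT/vec_mx_continuous.
apply: (@subclosed_compact _ _ [set v : 'rV[R]_(m * p) | forall i, v ord0 i \in `[-1, 1]%R]).
- by apply: preimage_closed => // x _; exact: vec_mx_continuous.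
- apply: (@rV_compact _ _ (fun=> `[(-1 : R), 1]%classic)) => _.
  exact: segment_compact.
- move=> v Kv k; rewrite in_itv/= -ler_norml.
  have [i [j ->]] : exists i j, k = mxvec_index i j by case/mxvec_indexP: k => i j; exists i, j.
  by have := K1 _ Kv i j; rewrite mxE.
Qed.

(** The Lipschitz bound is required on K only, because [aligned_cost] is controlled
only on orthogonal matrices. *)
Lemma lipschitz_attains_min m p (K : set 'M[R]_(m, p)) (f : 'M[R]_(m, p) -> R) (l : R) :
  K !=set0 -> closed K -> (forall x, K x -> forall i j, `|x i j| <= 1) ->
  0 <= l ->
  (forall x y, K x -> K y -> f x <= f y + l * \sum_i \sum_j `|x i j - y i j|) ->
  exists2 c, K c & forall t, K t -> f c <= f t.
Proof.
move=> K0 cK K1 l0 lf.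
have [|c /set_mem Kc cmin] := compact_EVT_min (f := f) K0 (compact_bounded_mx cK K1); last first.
  by exists c => // t Kt; apply: cmin; rewrite inE.
rewrite continuous_subspace_in => x /set_mem Kx.
apply/cvgrPdist_le => e e0; rewrite -nbhs_subspace_in// near_withinE.
pose g (y : 'M[R]_(m, p)) := l * \sum_i \sum_j `|x i j - y i j|.
have cg : continuous g.
  have c1 i j : continuous (fun y : 'M[R]_(m, p) => `|x i j - y i j|).
    move=> y; apply: (@continuous_comp _ _ _ (fun y : 'M[R]_(m, p) => x i j - y i j) Num.norm).
      by apply: continuousB; [exact: cst_continuous | exact: coord_continuous].
    exact: norm_continuous.
  have c2 : continuous (fun y : 'M[R]_(m, p) => \sum_i \sum_j `|x i j - y i j|).
    by apply: continuous_sum => i; apply: continuous_sum => j; exact: c1.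
  by move=> y; apply: continuousM; [exact: cst_continuous | exact: c2].
have gx : g x = 0.
  by rewrite /g big1 ?mulr0// => i _; rewrite big1// => j _; rewrite subrr normr0.
have /cvgrPdist_le/(_ e e0) := cg x; rewrite gx; apply: filterS => y /=.
rewrite sub0r normrN => ge Ky; rewrite ler_norml.
have := le_trans (ler_norm _) ge => {}ge.
have gs : l * (\sum_i \sum_j `|y i j - x i j|) = g y.
  by congr (_ * _); apply: eq_bigr => i _; apply: eq_bigr => j _; rewrite distrC.
have := lf x y Kx Ky; have := lf y x Ky Kx; rewrite gs -/(g y).
move=> h1 h2; change ((- e : R) <= f x - f y <= e); apply/andP; split; lra.
Qed.

End extreme_values.

(** * Finite optimal transport *)

Arguments transport_plans {R n} P Q _.

Section transport.
Context {R : realType} {n : nat}.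
Implicit Types (P Q S : cloud R n).


Definition transport_cost P Q (c sigma : 'M[R]_(npts P, npts Q)) : R :=
  \sum_i \sum_j sigma i j * c i j.

Definition transport_value P Q (c : 'M[R]_(npts P, npts Q)) : R :=
  minimum [set transport_cost c sigma | sigma in transport_plans P Q].

Lemma wt_le1 P i : wt P i <= 1.
Proof.
rewrite -(wt_sum P) (bigD1 i)//= lerDl sumr_ge0// => j _.
exact/ltW/wt_gt0.
Qed.

Lemma plan_itv P Q sigma : transport_plans P Q sigma ->
  forall i j, 0 <= sigma i j <= 1.
Proof.
move=> [s0 sr _] i j; rewrite s0 /=.
rewrite (le_trans _ (wt_le1 i))// -sr (bigD1 j)//= lerDl.
by rewrite sumr_ge0.
Qed.

Lemma product_plan P Q :
  transport_plans P Q (\matrix_(i, j) (wt P i * wt Q j)).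
Proof.
split=> [i j|i|j].
- by rewrite mxE mulr_ge0// ltW// wt_gt0.
- under eq_bigr do rewrite mxE.
  by rewrite -mulr_sumr wt_sum mulr1.
- under eq_bigr do rewrite mxE.
  by rewrite -mulr_suml wt_sum mul1r.
Qed.

Lemma closed_plans P Q : closed (transport_plans P Q).
Proof.
have -> : transport_plans P Q =
  (\bigcap_(ij in [set: 'I_(npts P) * 'I_(npts Q)])
     (fun s : 'M[R]_(npts P, npts Q) => s ij.1 ij.2) @^-1` [set x | 0 <= x]) `&`
  ((\bigcap_(i in [set: 'I_(npts P)])
     (fun s : 'M[R]_(npts P, npts Q) => \sum_j s i j) @^-1` [set x | x = wt P i]) `&`
  (\bigcap_(j in [set: 'I_(npts Q)])
     (fun s : 'M[R]_(npts P, npts Q) => \sum_i s i j) @^-1` [set x | x = wt Q j])).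
  apply/seteqP; split => s.
    by move=> [h1 h2 h3]; split; [|split] => ? _; rewrite /= ?h1 ?h2 ?h3.
  by move=> [h1 [h2 h3]]; split => [i j|i|j]; [exact: (h1 (i, j))|exact: h2|exact: h3].
apply: closedI; [|apply: closedI]; apply: closed_bigI => i _.
- by apply: preimage_closed; [move=> x _; exact: coord_continuous | exact: closed_ge].
- apply: preimage_closed; last exact: closed_eq.
  by move=> x _; apply: continuous_sum => j; exact: coord_continuous.
- apply: preimage_closed; last exact: closed_eq.
  by move=> x _; apply: continuous_sum => j; exact: coord_continuous.
Qed.

Lemma transport_value_spec P Q (c : 'M[R]_(npts P, npts Q)) :
  exists2 s, transport_plans P Q s & transport_value c = transport_cost c s /\
    forall t, transport_plans P Q t -> transport_value c <= transport_cost c t.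
Proof.
have [|||||s Ks smin] := @lipschitz_attains_min R _ _ (transport_plans P Q)
    (transport_cost c) (\sum_i \sum_j `|c i j|).
- by exists (\matrix_(i, j) (wt P i * wt Q j)); exact: product_plan.
- exact: closed_plans.
- move=> s /plan_itv h i j; have /andP[h0 h1] := h i j.
  by rewrite ger0_norm.
- by rewrite sumr_ge0// => i _; rewrite sumr_ge0.
- move=> s t _ _; rewrite -lerBlDl /transport_cost -sumrB mulr_suml.
  apply: ler_sum => i _; rewrite -sumrB mulr_suml; apply: ler_sum => j _.
  rewrite -mulrBl (le_trans (ler_norm _))// normrM mulrC ler_wpM2l//.
  rewrite (bigD1 i)//= (bigD1 j)//= -addrA lerDl addr_ge0// sumr_ge0// => k _.
  by rewrite sumr_ge0.
have E : transport_value c = transport_cost c s.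
  by apply: minimumE; [exists s | move=> _ [t Kt <-]; exact: smin].
by exists s => //; split => // t Kt; rewrite E; exact: smin.
Qed.

Lemma transport_value_le P Q (c sigma : 'M[R]_(npts P, npts Q)) :
  transport_plans P Q sigma -> transport_value c <= transport_cost c sigma.
Proof. by have [s _ [_ h]] := transport_value_spec c; exact: h. Qed.

Lemma transport_value_ge0 P Q (c : 'M[R]_(npts P, npts Q)) :
  (forall i j, 0 <= c i j) -> 0 <= transport_value c.
Proof.
have [s [s0 _ _] [-> _]] := transport_value_spec c => c0.
by rewrite sumr_ge0// => i _; rewrite sumr_ge0// => j _; rewrite mulr_ge0.
Qed.

(** An optimal plan for d is admissible for c, and its entries are at most 1. *)
Lemma transport_value_lipschitz P Q (c d : 'M[R]_(npts P, npts Q)) :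
  transport_value c <= transport_value d + \sum_i \sum_j `|c i j - d i j|.
Proof.
have [s Ks [-> _]] := transport_value_spec d.
apply: le_trans (transport_value_le c Ks) _.
rewrite -lerBlDl /transport_cost -sumrB.
apply: ler_sum => i _; rewrite -sumrB; apply: ler_sum => j _.
rewrite -mulrBr (le_trans (ler_norm _))// normrM.
have /andP[s0 s1] := plan_itv Ks i j.
by rewrite ger0_norm// ler_piMl.
Qed.

End transport.

(** * Measurability of Lipschitz functions *)

Section lipschitz_measurable.
Context {R : realType}.

(** This avoids comparing the Borel sets of the topology of matrices with the
product sigma-algebra: f (g x) < r if and only if f q + |g x - q|_1 < r for some
rational matrix q, which is a countable union of measurable conditions on the
entries of g x. *)
Lemma lipschitz_measurable d (T : measurableType d) m p (f : 'M[R]_(m, p) -> R)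
    (g : T -> 'M[R]_(m, p)) :
  (forall i j, measurable_fun setT (fun x => g x i j)) ->
  (forall x y, f x <= f y + \sum_i \sum_j `|x i j - y i j|) ->
  measurable_fun setT (f \o g).
Proof.
move=> mg lf.
pose N (q : 'M[rat]_(m, p)) x := \sum_i \sum_j `|g x i j - ratr (q i j)|.
have mN q : measurable_fun setT (N q).
  apply: measurable_sum => i; apply: measurable_sum => j.
  by apply: measurableT_comp => //; apply: measurable_funB.
apply: (measurability _ (RGenInftyO.measurableE R)) => //.
move=> _ [_ [r ->] <-]; rewrite setTI.
have -> : (f \o g) @^-1` `]-oo, r[ = \bigcup_(q : 'M[rat]_(m, p))
    (N q @^-1` `]-oo, (r - f (map_mx ratr q))[%classic).
  apply/seteqP; split => x /=; last first.
    move=> [q _]; rewrite /= !in_itv/= => h; apply: le_lt_trans (lf _ (map_mx ratr q)) _.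
    rewrite -ltrBrDl; apply: le_lt_trans h.
    by apply: ler_sum => i _; apply: ler_sum => j _; rewrite mxE.
  rewrite in_itv/= => fr.
  (* The bound is used twice, once in |g x - q| and once in f q <= f (g x) + |g x - q|,
     and the successor keeps the denominator positive and the inequality strict. *)
  pose e := (r - f (g x)) / (2 * (m * p).+1%:R).
  have e0 : 0 < e by rewrite divr_gt0 ?subr_gt0// mulr_gt0.
  have /choice[q0 q0P] : forall ij : 'I_m * 'I_p, exists q : rat, `|g x ij.1 ij.2 - ratr q| < e.
    move=> ij; have [q] := @rat_in_itvoo R (g x ij.1 ij.2 - e) (g x ij.1 ij.2 + e) ltac:(lra).
    rewrite in_itv/= => /andP[q1 q2]; exists q.
    by rewrite ltr_norml; apply/andP; split; lra.
  pose q : 'M[rat]_(m, p) := \matrix_(i, j) q0 (i, j).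
  exists q => //=; rewrite in_itv/=.
  have Nq : N q x <= (m * p)%:R * e.
    apply: (@le_trans _ _ (\sum_(i < m) \sum_(j < p) e)).
      by apply: ler_sum => i _; apply: ler_sum => j _; rewrite mxE; exact/ltW/(q0P (i, j)).
    by rewrite !sumr_const !card_ord -mulrnA [(p * m)%N]mulnC mulr_natl.
  have := lf (map_mx ratr q) (g x).
  rewrite (_ : \sum_i _ = N q x); last first.
    by apply: eq_bigr => i _; apply: eq_bigr => j _; rewrite mxE distrC.
  have he : (m * p).+1%:R * (2 * e) = r - f (g x).
    by rewrite /e mulrA (mulrC _ 2) mulrCA divff ?mulr1// mulf_neq0// pnatr_eq0.
  have : (m * p)%:R * e < (m * p).+1%:R * e by rewrite ltr_pM2r// ltr_nat.
  by move: he; rewrite mulrCA; lra.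
apply: countable_bigcupT_measurable; first exact: countableP.
by move=> q; apply: measurable_preimage => //; exact: mN.
Qed.

End lipschitz_measurable.
(** * Gluing and transposing plans *)

Section transport_properties.
Context {R : realType} {n : nat}.
Implicit Types (P Q S : cloud R n).

(** Glue plans s1 and s2 through the middle cloud: the mass sent from i to j via k
is s1 i k * s2 k j / wt S k, whose marginals on (i, k) and (k, j) are s1 and s2. *)
Lemma transport_value_glue P Q S (c : 'M[R]_(npts P, npts Q))
    (c1 : 'M[R]_(npts P, npts S)) (c2 : 'M[R]_(npts S, npts Q)) (a b : R) :
  (forall i k j, c i j <= a * c1 i k + b * c2 k j) ->
  transport_value c <= a * transport_value c1 + b * transport_value c2.
Proof.
move=> cab.
have [s1 [p1 r1 q1] [-> _]] := transport_value_spec c1.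
have [s2 [p2 r2 q2] [-> _]] := transport_value_spec c2.
have w0 k : wt S k != 0 by rewrite gt_eqF// wt_gt0.
pose g i k j := s1 i k * s2 k j / wt S k.
have g0 i k j : 0 <= g i k j.
  by rewrite /g divr_ge0 ?mulr_ge0// ltW// wt_gt0.
have gj i k : \sum_j g i k j = s1 i k.
  by rewrite /g -mulr_suml -mulr_sumr r2 mulfK.
have gi k j : \sum_i g i k j = s2 k j.
  by rewrite /g -mulr_suml -mulr_suml q1 mulrAC divff ?mul1r.
have pl : transport_plans P Q (\matrix_(i, j) \sum_k g i k j).
  split=> [i j|i|j].
  - by rewrite mxE sumr_ge0.
  - under eq_bigr do rewrite mxE.
    by rewrite exchange_big /= (eq_bigr (s1 i))// => k _; exact: gj.
  - under eq_bigr do rewrite mxE.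
    by rewrite exchange_big /= (eq_bigr (s2 ^~ j))// => k _; exact: gi.
apply: le_trans (transport_value_le c pl) _.
have -> : a * transport_cost c1 s1 + b * transport_cost c2 s2 =
    \sum_i \sum_j \sum_k g i k j * (a * c1 i k + b * c2 k j).
  transitivity (\sum_i \sum_j \sum_k (a * (g i k j * c1 i k) + b * (g i k j * c2 k j))); last first.
    by do 3 (apply: eq_bigr => ? _); ring.
  under [RHS]eq_bigr do under eq_bigr do rewrite big_split.
  under [RHS]eq_bigr do rewrite big_split.
  rewrite [RHS]big_split /=; congr (_ + _).
    rewrite /transport_cost mulr_sumr; apply: eq_bigr => i _.
    rewrite exchange_big /= mulr_sumr; apply: eq_bigr => k _.
    by rewrite -mulr_sumr -mulr_suml gj.
  rewrite exchange_big /= /transport_cost exchange_big /= mulr_sumr; apply: eq_bigr => j _.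
  rewrite exchange_big /= mulr_sumr; apply: eq_bigr => k _.
  by rewrite -mulr_sumr -mulr_suml gi.
rewrite /transport_cost; apply: ler_sum => i _; apply: ler_sum => j _.
by rewrite mxE mulr_suml; apply: ler_sum => k _; rewrite ler_wpM2l.
Qed.

Lemma transport_value_trmx P Q (c : 'M[R]_(npts P, npts Q)) (d : 'M[R]_(npts Q, npts P)) :
  (forall i j, d j i = c i j) -> transport_value d <= transport_value c.
Proof.
move=> dc; have [s [s0 sr sc] [-> _]] := transport_value_spec c.
have pl : transport_plans Q P s^T.
  by split=> [i j|i|j]; [rewrite mxE | under eq_bigr do rewrite mxE .. ].
apply: le_trans (transport_value_le d pl) _.
rewrite /transport_cost exchange_big /= le_eqVlt; apply/orP; left; apply/eqP.
by apply: eq_bigr => i _; apply: eq_bigr => j _; rewrite mxE dc.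
Qed.

End transport_properties.

(** * The sliced cost *)

Section sliced.
Context {R : realType} {n : nat}.
Context (n_gt0 : (0 < n)%N).
Implicit Types (P Q S : cloud R n) (A B : 'M[R]_n) (u v theta : 'rV[R]_n).
Notation nu := (surface_measure R n).
Notation sph := (sphere R n).
Notation On := (orthogonal_group R n).

Definition cost_mx P Q A theta : 'M[R]_(npts P, npts Q) :=
  \matrix_(i, j) `|edot (pt P i *m A) theta - edot (pt Q j) theta| ^+ 2.

Lemma sliced_W2_sqE P Q A theta :
  sliced_W2_sq P Q A theta = transport_value (cost_mx P Q A theta).
Proof.
rewrite /sliced_W2_sq /transport_value; congr minimum.
have -> : transport_cost (cost_mx P Q A theta) = sliced_cost A theta => //.
apply/funext => s; apply: eq_bigr => i _; apply: eq_bigr => j _.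
by rewrite mxE.
Qed.

Lemma cost_mx_ge0 P Q A theta i j : 0 <= cost_mx P Q A theta i j.
Proof. by rewrite mxE exprn_ge0. Qed.

Lemma sliced_W2_sq_ge0 P Q A theta : 0 <= sliced_W2_sq P Q A theta.
Proof.
by rewrite sliced_W2_sqE; apply: transport_value_ge0 => i j; exact: cost_mx_ge0.
Qed.

Lemma measurable_sliced_W2_sq P Q A :
  measurable_fun setT (sliced_W2_sq P Q A).
Proof.
rewrite (_ : sliced_W2_sq P Q A = (@transport_value _ _ P Q) \o cost_mx P Q A); last first.
  by apply/funext => theta; rewrite sliced_W2_sqE.
apply: lipschitz_measurable => [i j|]; last exact: transport_value_lipschitz.
rewrite (_ : (fun _ => _) = (fun theta =>
   `|edot (pt P i *m A) theta - edot (pt Q j) theta| ^+ 2)); last first.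
  by apply/funext => theta; rewrite mxE.
apply: measurable_funX; apply: measurableT_comp => //.
by apply: measurable_funB; exact: measurable_edot.
Qed.

Definition l1norm u : R := \sum_i `|u ord0 i|.

Lemma l1norm_ge0 u : 0 <= l1norm u.
Proof. by rewrite sumr_ge0. Qed.

Lemma edot_sphere_le u theta : sph theta -> `|edot u theta| <= l1norm u.
Proof.
move=> st; rewrite edotE (le_trans (ler_norm_sum _ _ _))//.
apply: ler_sum => i _; rewrite normrM ler_piMr//.
by rewrite (le_trans (coord_le_enorm _ _))// st.
Qed.

Lemma edot_orthogonal_le u A theta : On A -> sph theta ->
  `|edot (u *m A) theta| <= l1norm u.
Proof.
move=> AO st; rewrite edot_mulmx; apply: edot_sphere_le.
by rewrite /sphere /= enorm_orthogonal//; exact: orthogonal_trmx.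
Qed.

Lemma sliced_W2_sq_le P Q A theta : On A -> sph theta ->
  sliced_W2_sq P Q A theta <=
  \sum_i \sum_j (l1norm (pt P i) + l1norm (pt Q j)) ^+ 2.
Proof.
move=> AO st; rewrite sliced_W2_sqE.
apply: le_trans (transport_value_le _ (product_plan P Q)) _.
apply: ler_sum => i _; apply: ler_sum => j _.
have /andP[s0 s1] := plan_itv (product_plan P Q) i j.
apply: (@le_trans _ _ (cost_mx P Q A theta i j)).
  by rewrite ler_piMl// cost_mx_ge0.
rewrite mxE ler_pXn2r ?nnegrE ?addr_ge0 ?l1norm_ge0//.
rewrite (le_trans (ler_normB _ _))// lerD//.
  exact: edot_orthogonal_le.
exact: edot_sphere_le.
Qed.

Lemma bounded_sphere_integrable (f : 'rV[R]_n -> R) (M : R) :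
  measurable_fun setT f -> (forall v, sph v -> 0 <= f v <= M) ->
  nu.-integrable sph (EFin \o f).
Proof.
move=> mf fM; apply: measurable_bounded_integrable.
- exact: measurable_sphere.
- by apply: surface_measure_lty => //; exact: measurable_sphere.
- exact: measurable_funTS.
- exists M; split; first exact: num_real.
  move=> x Mx v sv; have /andP[f0 f1] := fM v sv.
  by rewrite /= ger0_norm// (le_trans f1)// ltW.
Qed.

Lemma integrable_sliced_W2_sq P Q A : On A ->
  nu.-integrable sph (EFin \o sliced_W2_sq P Q A).
Proof.
move=> AO; apply: bounded_sphere_integrable; first exact: measurable_sliced_W2_sq.
by move=> v sv; rewrite sliced_W2_sq_ge0; exact: sliced_W2_sq_le.
Qed.

Lemma integrable_sliced_W2_sq_rotated P Q A B : On A -> On B ->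
  nu.-integrable sph (EFin \o (fun v => sliced_W2_sq P Q A (v *m B))).
Proof.
move=> AO BO; apply: bounded_sphere_integrable.
  exact: (measurableT_comp (measurable_sliced_W2_sq P Q A) (measurable_mulmxr B)).
move=> v sv; rewrite sliced_W2_sq_ge0; apply: sliced_W2_sq_le => //.
by rewrite /sphere /= enorm_orthogonal.
Qed.

Definition aligned_cost P Q A : R := \int[nu]_(theta in sph) sliced_W2_sq P Q A theta.

Lemma aligned_cost_ge0 P Q A : 0 <= aligned_cost P Q A.
Proof. by apply: Rintegral_ge0 => v _; exact: sliced_W2_sq_ge0. Qed.

Lemma l1norm_mulmx u A : l1norm (u *m A) <= l1norm u * \sum_i \sum_j `|A i j|.
Proof.
rewrite /l1norm [X in _ * X]exchange_big /= mulr_sumr; apply: ler_sum => j _.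
rewrite mxE (le_trans (ler_norm_sum _ _ _))// mulr_suml; apply: ler_sum => i _.
rewrite normrM ler_wpM2l// (bigD1 i)//= lerDl.
by rewrite sumr_ge0.
Qed.

Lemma cost_mx_lipschitz P Q A B theta i j : On A -> On B -> sph theta ->
  `|cost_mx P Q A theta i j - cost_mx P Q B theta i j| <=
  2 * (l1norm (pt P i) + l1norm (pt Q j)) * l1norm (pt P i) *
  \sum_k \sum_l `|A k l - B k l|.
Proof.
move=> AO BO st; rewrite !mxE !real_normK ?num_real// subr_sqr normrM.
rewrite -mulrA mulrC; apply: ler_pM => //.
  have -> : 2 * (l1norm (pt P i) + l1norm (pt Q j)) =
    (l1norm (pt P i) + l1norm (pt Q j)) + (l1norm (pt P i) + l1norm (pt Q j)) by ring.
  rewrite (le_trans (ler_normD _ _))// lerD// (le_trans (ler_normB _ _))// lerD//;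
    by [exact: edot_orthogonal_le | exact: edot_sphere_le].
have -> : edot (pt P i *m A) theta - edot (pt Q j) theta -
  (edot (pt P i *m B) theta - edot (pt Q j) theta) = edot (pt P i *m (A - B)) theta.
  by rewrite mulmxBr edotDl edotNl; ring.
rewrite (le_trans (edot_sphere_le _ st))// (le_trans (l1norm_mulmx _ _))//.
rewrite ler_wpM2l ?l1norm_ge0//; apply: ler_sum => k _; apply: ler_sum => l _.
by rewrite !mxE.
Qed.

(** On the sphere the entries of the cost matrices are Lipschitz in A, with constants
independent of theta ([cost_mx_lipschitz]); the total mass of the sphere is
finite. *)
Lemma aligned_cost_lipschitz P Q : exists2 l : R, 0 <= l &
  forall A B, On A -> On B -> aligned_cost P Q A <=
    aligned_cost P Q B + l * \sum_i \sum_j `|A i j - B i j|.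
Proof.
pose K : R := \sum_i \sum_j (2 * (l1norm (pt P i) + l1norm (pt Q j)) * l1norm (pt P i)).
have K0 : 0 <= K.
  by rewrite sumr_ge0// => i _; rewrite sumr_ge0// => j _; rewrite !mulr_ge0 ?addr_ge0 ?l1norm_ge0.
exists (K * fine (nu sph)); first by rewrite mulr_ge0// fine_ge0.
move=> A B AO BO; set N := \sum_i \sum_j _.
have N0 : 0 <= N by rewrite sumr_ge0// => i _; rewrite sumr_ge0.
have icst : nu.-integrable sph (EFin \o cst (K * N)).
  by apply: (@bounded_sphere_integrable _ (K * N)) => // v _; rewrite /= mulr_ge0/=.
rewrite mulrAC -Rintegral_cst; last exact: measurable_sphere.
rewrite /aligned_cost -RintegralD//; [|exact: measurable_sphere|exact: integrable_sliced_W2_sq].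
apply: le_Rintegral.
- exact: measurable_sphere.
- exact: integrable_sliced_W2_sq.
- have -> : EFin \o (fun x => sliced_W2_sq P Q B x + K * N) =
      ((EFin \o sliced_W2_sq P Q B) \+ (EFin \o cst (K * N)%R))%E by apply/funext.
  by apply: integrableD => //; [exact: measurable_sphere | exact: integrable_sliced_W2_sq].
- move=> v sv; rewrite !sliced_W2_sqE.
  apply: le_trans (transport_value_lipschitz _ (cost_mx P Q B v)) _.
  rewrite lerD2l /K mulr_suml; apply: ler_sum => i _.
  by rewrite mulr_suml; apply: ler_sum => j _; exact: cost_mx_lipschitz.
Qed.

Lemma orthogonal_entry_le1 A : On A -> forall i j, `|A i j| <= 1.
Proof.
move=> AO i j; have := congr1 (fun M : 'M[R]_n => M i i) AO.
rewrite !mxE eqxx /= => H.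
rewrite -(ler_pXn2r (isT : (0 < 2)%N)) ?nnegrE// expr1n real_normK ?num_real//.
rewrite -[leRHS]H (bigD1 j)//= mxE -expr2 lerDl sumr_ge0// => k _.
by rewrite mxE -expr2 sqr_ge0.
Qed.

Lemma closed_orthogonal : closed On.
Proof.
have -> : On = \bigcap_(ij in [set: 'I_n * 'I_n])
   (fun A : 'M[R]_n => \sum_k A (fst ij) k * A (snd ij) k) @^-1`
     [set x | x = (fst ij == snd ij)%:R].
  apply/seteqP; split => A.
    move=> /= AO [i j] _ /=; have := congr1 (fun M : 'M[R]_n => M i j) AO.
    by rewrite !mxE => <-; apply: eq_bigr => k _; rewrite mxE.
  move=> H; apply/matrixP => i j; rewrite !mxE -[RHS](H (i, j) I).
  by apply: eq_bigr => k _; rewrite mxE.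
apply: closed_bigI => ij _; apply: preimage_closed; last exact: closed_eq.
move=> x _; apply: continuous_sum => k y.
by apply: continuousM; exact: coord_continuous.
Qed.

(** * Metric properties of the distance *)

Lemma RSWD_sq_spec P Q : exists2 A, On A & RSWD_sq P Q = aligned_cost P Q A /\
  forall B, On B -> RSWD_sq P Q <= aligned_cost P Q B.
Proof.
have [l l0 lip] := aligned_cost_lipschitz P Q.
have [|A AO Amin] := lipschitz_attains_min _ closed_orthogonal orthogonal_entry_le1 l0 lip.
  by exists 1%:M; exact: orthogonal1.
have E : RSWD_sq P Q = aligned_cost P Q A.
  by apply: minimumE; [exists A | move=> _ [B BO <-]; exact: Amin].
by exists A => //; split => // B BO; rewrite E; exact: Amin.
Qed.

Lemma RSWD_sq_ge0 P Q : 0 <= RSWD_sq P Q.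
Proof. by have [A _ [-> _]] := RSWD_sq_spec P Q; exact: aligned_cost_ge0. Qed.

(** The change of variable theta |-> theta A^T carries the rotation from one cloud to
the other. *)
Lemma aligned_cost_trmx P Q A : On A -> aligned_cost Q P A^T <= aligned_cost P Q A.
Proof.
move=> AO; have AO' := orthogonal_trmx AO.
rewrite /aligned_cost -(surface_integral_orthogonal n_gt0 AO'
  (measurable_sliced_W2_sq _ _ _) (sliced_W2_sq_ge0 Q P A^T)).
apply: le_Rintegral.
- exact: measurable_sphere.
- exact: integrable_sliced_W2_sq_rotated.
- exact: integrable_sliced_W2_sq.
- move=> v sv; rewrite !sliced_W2_sqE; apply: transport_value_trmx => i j.
  by rewrite !mxE distrC !edot_mulmx trmxK -mulmxA (mulmx1C AO) mulmx1.
Qed.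

Lemma RSWD_sq_sym P Q : RSWD_sq P Q = RSWD_sq Q P.
Proof.
suff le (X Y : cloud R n) : RSWD_sq X Y <= RSWD_sq Y X by apply/eqP; rewrite eq_le !le.
have [A AO [-> _]] := RSWD_sq_spec Y X; have [_ _ [_ h]] := RSWD_sq_spec X Y.
exact: le_trans (h _ (orthogonal_trmx AO)) (aligned_cost_trmx _ _ AO).
Qed.

(** The difference of the two sides is a square:
((1 - t) (x - y) - t (y - z))^2 / (t (1 - t)). *)
Lemma sqr_convex (x y z t : R) : 0 < t < 1 ->
  `|x - z| ^+ 2 <= t^-1 * `|x - y| ^+ 2 + (1 - t)^-1 * `|y - z| ^+ 2.
Proof.
move=> /andP[t0 t1]; rewrite !real_normK ?num_real//.
have t1' : 0 < 1 - t by lra.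
have t0n : t != 0 by rewrite gt_eqF.
have t1n : 1 - t != 0 by rewrite gt_eqF.
rewrite -subr_ge0.
have -> : t^-1 * (x - y) ^+ 2 + (1 - t)^-1 * (y - z) ^+ 2 - (x - z) ^+ 2 =
  ((1 - t) * (x - y) - t * (y - z)) ^+ 2 / (t * (1 - t)).
  by field; rewrite t0n t1n.
by rewrite divr_ge0 ?sqr_ge0// mulr_ge0// ltW.
Qed.

(** The rotation theta |-> theta B^T aligns the two slices of S: the projection of
S on theta B^T is the projection on theta of S rotated by B. *)
Lemma aligned_cost_glue P Q S A B (t : R) : On A -> On B -> 0 < t < 1 ->
  aligned_cost P Q (A *m B) <=
  t^-1 * aligned_cost P S A + (1 - t)^-1 * aligned_cost S Q B.
Proof.
move=> AO BO t01; have BO' := orthogonal_trmx BO.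
have ABO := orthogonal_mulmx AO BO.
have mS := @measurable_sphere R n.
have i1 := integrable_sliced_W2_sq_rotated P S AO BO'.
have i2 := integrable_sliced_W2_sq S Q BO.
rewrite /aligned_cost -(surface_integral_orthogonal n_gt0 BO'
  (measurable_sliced_W2_sq P S A) (sliced_W2_sq_ge0 P S A)).
rewrite -!RintegralZl//.
have j1 : nu.-integrable sph (EFin \o (fun v => t^-1 * sliced_W2_sq P S A (v *m B^T))).
  have -> : EFin \o (fun v => t^-1 * sliced_W2_sq P S A (v *m B^T)) =
    (fun v => (t^-1)%:E * (EFin \o (fun v => sliced_W2_sq P S A (v *m B^T))) v)%E by apply/funext.
  exact: integrableZl.
have j2 : nu.-integrable sph (EFin \o (fun v => (1 - t)^-1 * sliced_W2_sq S Q B v)).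
  have -> : EFin \o (fun v => (1 - t)^-1 * sliced_W2_sq S Q B v) =
    (fun v => ((1 - t)^-1)%:E * (EFin \o sliced_W2_sq S Q B) v)%E by apply/funext.
  exact: integrableZl.
rewrite -RintegralD//.
apply: le_Rintegral => //.
- exact: integrable_sliced_W2_sq.
- have -> : EFin \o (fun v => t^-1 * sliced_W2_sq P S A (v *m B^T) +
      (1 - t)^-1 * sliced_W2_sq S Q B v)
    = ((EFin \o (fun v => t^-1 * sliced_W2_sq P S A (v *m B^T))%R) \+
       (EFin \o (fun v => (1 - t)^-1 * sliced_W2_sq S Q B v)%R))%E by apply/funext.
  exact: integrableD.
- move=> v sv; rewrite !sliced_W2_sqE; apply: transport_value_glue => i k j.
  rewrite !mxE mulmxA [edot (_ *m B) v]edot_mulmx [edot (pt S k *m B) v]edot_mulmx.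
  exact: sqr_convex.
Qed.

Lemma RSWD_triangle P Q S : RSWD P Q <= RSWD P S + RSWD S Q.
Proof.
have [A AO [EA _]] := RSWD_sq_spec P S; have [B BO [EB _]] := RSWD_sq_spec S Q.
have [_ _ [_ h]] := RSWD_sq_spec P Q.
have a0 : 0 <= RSWD P S by exact: sqrtr_ge0.
have b0 : 0 <= RSWD S Q by exact: sqrtr_ge0.
have a2 : aligned_cost P S A = RSWD P S ^+ 2 by rewrite -EA sqr_sqrtr// RSWD_sq_ge0.
have b2 : aligned_cost S Q B = RSWD S Q ^+ 2 by rewrite -EB sqr_sqrtr// RSWD_sq_ge0.
(* The shift by e / 2 makes the optimal weight t = a' / (a' + b') lie in ]0, 1[ even
   when a or b is 0. *)
apply/ler_addgt0Pr => e e0.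
set a := RSWD P S in a0 a2 *; set b := RSWD S Q in b0 b2 *.
pose a' := a + e / 2; pose b' := b + e / 2.
have a'0 : 0 < a' by rewrite /a'; lra.
have b'0 : 0 < b' by rewrite /b'; lra.
have ab0 : 0 < a' + b' by lra.
have t01 : 0 < a' / (a' + b') < 1.
  by rewrite divr_gt0//= ltr_pdivrMr// mul1r ltrDl.
have -> : a + b + e = a' + b' by rewrite /a' /b'; lra.
rewrite -(ler_pXn2r (isT : (0 < 2)%N)) ?nnegrE ?sqrtr_ge0 ?(ltW ab0)//.
rewrite sqr_sqrtr ?RSWD_sq_ge0//.
apply: le_trans (h _ (orthogonal_mulmx AO BO)) _.
apply: le_trans (aligned_cost_glue P Q S AO BO t01) _.
rewrite a2 b2.
apply: (@le_trans _ _ ((a' / (a' + b'))^-1 * a' ^+ 2 + (1 - a' / (a' + b'))^-1 * b' ^+ 2)).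
  case/andP: t01 => t0 t1.
  apply: lerD; (rewrite ler_wpM2l; [by [] | by rewrite invr_ge0 ?subr_ge0 ltW | ]);
    by rewrite ler_pXn2r ?nnegrE// ?ltW// /a' /b'; lra.
have -> : 1 - a' / (a' + b') = b' / (a' + b') by field; rewrite gt_eqF.
rewrite le_eqVlt; apply/orP; left; apply/eqP; field.
by rewrite !gt_eqF.
Qed.

Lemma zero_cost_plan P Q (c : 'M[R]_(npts P, npts Q)) :
  (forall i j, 0 <= c i j) -> transport_value c = 0 ->
  exists2 s, transport_plans P Q s & forall i j, s i j != 0 -> c i j = 0.
Proof.
move=> c0 tc; have [s pl [E _]] := transport_value_spec c.
have [s0 _ _] := pl; exists s => // i j sij.
have sc i' j' : 0 <= s i' j' * c i' j' by rewrite mulr_ge0.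
have H : transport_cost c s = 0 by rewrite -E.
have H1 := psumr_eq0P (fun i' _ => sumr_ge0 _ (fun j' _ => sc i' j')) H (i := i) isT.
have H2 := psumr_eq0P (fun j' _ => sc i j') H1 (i := j) isT.
by move/eqP: H2; rewrite mulf_eq0 (negPf sij) => /eqP.
Qed.

(** Almost every direction has zero cost, and almost every direction avoids the
finitely many hyperplanes orthogonal to the nonzero p_i A - q_j; as the sphere
has positive measure, some direction does both. *)
Lemma generic_direction P Q A : On A -> aligned_cost P Q A = 0 ->
  exists theta, sliced_W2_sq P Q A theta = 0 /\
    forall i j, edot (pt P i *m A - pt Q j) theta = 0 -> pt P i *m A = pt Q j.
Proof.
move=> AO F0.
pose f := sliced_W2_sq P Q A.
have fint : nu.-integrable sph (EFin \o f) by exact: integrable_sliced_W2_sq.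
have mS := @measurable_sphere R n.
have If0 : (\int[nu]_(v in sph) (EFin \o f) v = 0)%E.
  by rewrite -(fineK (integrable_fin_num mS fint)); congr EFin.
have aef : {ae nu, forall v, sph v -> f v = 0}.
  have mf : measurable_fun sph (EFin \o f) by case/integrableP: fint.
  have /(ae_eq_integral_abs nu mS mf) : (\int[nu]_(v in sph) `|(EFin \o f) v| = 0)%E.
    rewrite -[RHS]If0; apply: eq_integral => v _.
    by rewrite gee0_abs// lee_fin sliced_W2_sq_ge0.
  by apply: filterS => v fv sv; have /= := fv sv; case.
have aeH : {ae nu, forall v, forall ij : 'I_(npts P) * 'I_(npts Q),
    edot (pt P ij.1 *m A - pt Q ij.2) v = 0 -> pt P ij.1 *m A = pt Q ij.2}.
  apply: filter_forall => -[i j] /=.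
  have [/eqP|d0] := eqVneq (pt P i *m A - pt Q j) 0.
    by rewrite subr_eq0 => /eqP ->; apply: aeW.
  exists [set v | edot (pt P i *m A - pt Q j) v = 0]; split.
  - apply: (@measurable_preimage _ _ _ _ (edot (pt P i *m A - pt Q j)) [set 0]) => //.
    exact: measurable_edot.
  - exact: surface_measure_hyperplane.
  - by move=> v /= /not_implyP[].
apply: contrapT => H.
have : nu.-negligible sph.
  have : {ae nu, forall v, ~ sph v}.
    apply: filterS2 aef aeH => v fv Hv sv; apply: H; exists v; split; first exact: fv.
    by move=> i j; exact: (Hv (i, j)).
  by apply: negligibleS => v /= sv; rewrite notK.
move/negligibleP => /(_ mS) n0.
by have := surface_measure_sphere_gt0 n_gt0 (R := R); rewrite n0 ltxx.
Qed.

(** Each row of the plan has a nonzero entry, and only one because the points of Q are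
distinct; likewise for columns.  So the plan is supported on the graph of a
bijection, and its marginals identify the weights. *)
Lemma matching_plan_equiv P Q A s : On A -> transport_plans P Q s ->
  (forall i j, s i j != 0 -> pt P i *m A = pt Q j) -> cloud_equiv P Q.
Proof.
move=> AO [s0 sr sc] sA.
have ex i : exists j, s i j != 0.
  apply: contrapT => H; have := wt_gt0 i; rewrite -sr big1 ?ltxx// => j _.
  by apply/eqP; apply: contrapT => /negP sij; apply: H; exists j.
have ex' j : exists i, s i j != 0.
  apply: contrapT => H; have := wt_gt0 j; rewrite -sc big1 ?ltxx// => i _.
  by apply/eqP; apply: contrapT => /negP sij; apply: H; exists i.
have [f fP] := choice ex; have [g gP] := choice ex'.
have fE i j : s i j != 0 -> f i = j.
  by move=> sij; apply: (@pt_inj _ _ Q); rewrite -(sA _ _ sij) -(sA _ _ (fP i)).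
have gK : cancel g f by move=> j; exact: fE.
have fK : cancel f g.
  move=> i; apply: (@pt_inj _ _ P).
  have : pt P (g (f i)) *m A = pt P i *m A by rewrite (sA _ _ (gP (f i))) (sA _ _ (fP i)).
  by move/(congr1 (mulmxr A^T)); rewrite /= -!mulmxA AO !mulmx1.
have e : npts P = npts Q by have := bij_eq_card (Bijective fK gK); rewrite !card_ord.
have hinj : injective (fun i => cast_ord (esym e) (f i)).
  by move=> i j /cast_ord_inj /(can_inj fK).
exists e, A, (perm hinj); split => // i; rewrite permE cast_ordKV.
split; first exact: sA.
rewrite -sr -sc (bigD1 (f i))//= [RHS](bigD1 i)//= !big1 ?addr0//.
  move=> k ki; apply/eqP; apply: contraNT ki => /fE H.
  by apply/eqP/(can_inj fK).
by move=> j ji; apply/eqP; apply: contraNT ji => /fE ->.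
Qed.

Lemma RSWD_sq_eq0_equiv P Q : RSWD_sq P Q = 0 -> cloud_equiv P Q.
Proof.
have [A AO [-> _]] := RSWD_sq_spec P Q => F0.
have [v [W0 Hv]] := generic_direction AO F0.
have [s pl sc] := zero_cost_plan (@cost_mx_ge0 P Q A v) (etrans (esym (sliced_W2_sqE P Q A v)) W0).
apply: (matching_plan_equiv AO pl) => i j /sc; rewrite mxE => /eqP.
rewrite sqrf_eq0 normr_eq0 => /eqP H; apply: Hv.
by rewrite edotDl edotNl.
Qed.

(** The plan carried by the graph of the permutation has zero cost in every
direction. *)
Lemma equiv_RSWD_sq_eq0 P Q : cloud_equiv P Q -> RSWD_sq P Q = 0.
Proof.
move=> [e [A [s [AO H]]]].
apply/eqP; rewrite eq_le RSWD_sq_ge0 andbT.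
have [_ _ [_ h]] := RSWD_sq_spec P Q; apply: le_trans (h A AO) _.
rewrite le_eqVlt; apply/orP; left; apply/eqP; rewrite /aligned_cost.
pose f i := cast_ord e (s i).
pose g j := (s^-1)%g (cast_ord (esym e) j).
have fK : cancel f g by move=> i; rewrite /g /f cast_ordK permK.
have gK : cancel g f by move=> i; rewrite /g /f permKV cast_ordKV.
pose sg : 'M[R]_(npts P, npts Q) := \matrix_(i, j) (wt P i *+ (j == f i)).
have pl : transport_plans P Q sg.
  split=> [i j|i|j].
  - by rewrite mxE mulrn_wge0// ltW// wt_gt0.
  - rewrite (bigD1 (f i))//= mxE eqxx big1 ?addr0// => j ji.
    by rewrite mxE (negPf ji).
  - rewrite (bigD1 (g j))//= mxE gK eqxx big1 ?addr0.
      by have [_ ->] := H (g j); rewrite -/(f (g j)) gK.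
    move=> i ij; rewrite mxE; case: eqP => // ji.
    by rewrite ji fK eqxx in ij.
rewrite (@eq_Rintegral _ _ _ nu sph (cst 0)) ?Rintegral_cst ?mul0r//.
  exact: measurable_sphere.
move=> v _; apply/eqP; rewrite eq_le sliced_W2_sq_ge0 andbT sliced_W2_sqE.
apply: le_trans (transport_value_le _ pl) _.
rewrite /transport_cost big1// => i _; rewrite big1// => j _; rewrite !mxE.
case: eqP => [->|_]; last by rewrite mul0r.
by have [-> _] := H i; rewrite -/(f i) subrr normr0 expr0n mulr0.
Qed.

Lemma RSWD_eq0 P Q : RSWD P Q = 0 <-> cloud_equiv P Q.
Proof.
split=> [/eqP|/equiv_RSWD_sq_eq0 H]; last by rewrite /RSWD H sqrtr0.
rewrite sqrtr_eq0 => H; apply: RSWD_sq_eq0_equiv.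
by apply/eqP; rewrite eq_le H RSWD_sq_ge0.
Qed.

Lemma RSWD_sym P Q : RSWD P Q = RSWD Q P.
Proof. by rewrite /RSWD RSWD_sq_sym. Qed.

(** Equivalent clouds are at distance 0, so this is the triangle inequality used in
both directions. *)
Lemma RSWD_equivl P P' Q : cloud_equiv P P' -> RSWD P Q = RSWD P' Q.
Proof.
move=> PP'; apply/eqP; rewrite eq_le.
have /RSWD_eq0 E := PP'; have /RSWD_eq0 E' := cloud_equiv_sym PP'.
have := RSWD_triangle P Q P'; have := RSWD_triangle P' Q P.
by rewrite E E' !add0r => -> ->.
Qed.

End sliced.

Theorem theorem4 (R : realType) (n : nat) (n_gt0 : (0 < n)%N) :
  (forall P Q : cloud R n,
    [/\ forall P' : cloud R n, cloud_equiv P P' -> RSWD P Q = RSWD P' Q,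
        0 <= RSWD P Q /\ (RSWD P Q = 0 <-> cloud_equiv P Q),
        RSWD P Q = RSWD Q P &
        forall S : cloud R n, RSWD P Q <= RSWD P S + RSWD S Q]) /\
  (exists d : cloud_quotient R n -> cloud_quotient R n -> R,
    (forall P Q : cloud R n,
      d (\pi_(cloud_quotient R n) P) (\pi_(cloud_quotient R n) Q) = RSWD P Q) /\
    is_metric d).
Proof.
split=> [P Q|].
  split.
  - by move=> P'; exact: RSWD_equivl.
  - by split; [exact: sqrtr_ge0 | exact: RSWD_eq0].
  - exact: RSWD_sym.
  - by move=> S; exact: RSWD_triangle.
have reprP (P : cloud R n) : cloud_equiv (repr (\pi_(cloud_quotient R n) P)) P.
  have /eqmodP /asboolP := reprK (\pi_(cloud_quotient R n) P).
  exact.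
exists (fun x y => RSWD (repr x) (repr y)); split=> [P Q|].
  rewrite (RSWD_equivl n_gt0 _ (reprP P)) RSWD_sym// (RSWD_equivl n_gt0 _ (reprP Q)).
  exact: RSWD_sym.
split=> [x y|x y|x y|x y z].
- exact: sqrtr_ge0.
- split=> [/RSWD_eq0 xy|->]; last by apply/RSWD_eq0 => //; exact: cloud_equiv_refl.
  rewrite -(reprK x) -(reprK y); apply/eqmodP; apply/asboolP; exact: xy.
- exact: RSWD_sym.
- exact: RSWD_triangle.
Qed.
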